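(* Let $\Omega\subset\mathbb{R}^2$ have finite area $|\Omega|$, and let $T\subset\Omega$ be a polygon whose boundary is a simple closed polygonal curve with $n_l$ edges; let $l_i$ be the length of the $i$-th edge and $\phi_i\in(0,2\pi)$ the inner angle formed by the $i$-th and $(i+1)$-th edges (indices mod $n_l$); let $|T|$ and $L(T)$ be its area and perimeter. Fix $r_{max}>0$ with every point within distance $r_{max}$ of $T$ in $\Omega$. A sensor is placed at $(x,y)$ uniform in $\Omega$ with direction $\theta$ uniform in $[0,2\pi)$, independently, and measures $s=\min\{t\in[0,r_{max}]:(x+t\cos\theta,y+t\sin\theta)\in T\}$ (or $s=\emptyset$ if the set is empty). Assume that, within sensing range, the set of sensor positions whose detected point lies on a given edge is obstructed by $T$ only at the vertices shared with the two adjacent edges (interference from non-adjacent edges is neglected). Then for $0<r\le r_{max}$, $$\Pr(s\le r)=\frac{1}{2\pi|\Omega|}\Big\{2L(T)r+2\pi|T|-\sum_{k\in\{12,3,4\}}\sum_{i}\sum_{l\in\{l_i,l_{i+1}\}}\mathbf{1}(C_k(\phi_i,l,r))\,g_k(\phi_i,l,r)\Big\},$$ with $C_k$ and $g_k$ as defined in the context.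
   Context: $\mathbf 1(\cdot)$ is the indicator, $[t]^+=\max(t,0)$, and $\arcsin$ takes values in $[-\pi/2,\pi/2]$. Conditions: $C_1(\phi,l,r)$: $3\pi/2<\phi<2\pi$ and $r<l|\sin\phi|$; $C_2(\phi,l,r)$: $\pi<\phi\le3\pi/2$ and $r<l$; $C_3(\phi,l,r)$: $3\pi/2<\phi<2\pi$ and $l|\sin\phi|\le r$; $C_4(\phi,l,r)$: $\pi<\phi\le 3\pi/2$ and $l\le r$; $C_{12}=C_1\cup C_2$. Functions: $g_1(\phi)=-2+2(\phi-\pi)/\tan\phi$; $g_{12}(\phi,l,r)=-r^2g_1(\phi)/8$; $\gamma=l\sin(2\pi-\phi)/r$; $\zeta_1=\phi-\pi-\arcsin\gamma$; $\zeta_2=\phi-\pi-(\pi-\arcsin\gamma)$; $g_{3,1}=-2\gamma^2+\frac{1}{\tan\phi}(2\arcsin\gamma-2\gamma\sqrt{1-\gamma^2})$; $g_{3,2}=\frac{1}{\tan\phi}\big(-2(-\arcsin\gamma-\phi+2\pi)-2\gamma\sqrt{1-\gamma^2}-\sin(2\phi)\big)-1+2\gamma^2+\cos(2\phi)$; $g_{3,3}=\frac{l^2\sin\phi}{2}\big(\zeta_1\cos\phi-\sin\phi(\log|\sin\phi|-\log\gamma)\big)$; $g_{3,4}=\frac{l^2\sin\phi}{2}(\pi-2\arcsin\gamma)\cos\phi$; $g_3=lr(\cos([\zeta_2]^+)-\cos\zeta_1)-\frac{r^2}{8}g_{3,1}+(-\frac{r^2}{8}g_{3,2}+g_{3,4})\mathbf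 1(\zeta_2>0)+g_{3,3}\mathbf 1(\zeta_2\le0)$; $g_4=lr(1-\cos\zeta_1)-\frac{r^2}{8}g_{3,1}+g_{3,3}$. Here all of $\gamma,\zeta_1,\zeta_2,g_{3,j},g_3,g_4$ are evaluated at $(\phi,l,r)$. *)

(* Defs.v *)
From HB Require Import structures.
From mathcomp Require Import all_boot all_order all_algebra.
From mathcomp Require Import all_classical all_reals all_analysis.
Set Implicit Arguments. Unset Strict Implicit. Unset Printing Implicit Defensive.
Import Order.TTheory GRing.Theory Num.Theory.
Import numFieldNormedType.Exports.
Local Open Scope classical_set_scope.
Local Open Scope ring_scope.

Section Sensor.
Variable R : realType.

Definition pt := (R * R)%type.
(* configuration (sensor position, sensor direction) *)
Definition cfg := ((R * R) * R)%type.

Definition leb2 := (@lebesgue_measure R \x @lebesgue_measure R)%E.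
Definition leb3 := (leb2 \x @lebesgue_measure R)%E.

Definition vsub (a b : pt) : pt := (a.1 - b.1, a.2 - b.2).
Definition dotp (u w : pt) : R := u.1 * w.1 + u.2 * w.2.
Definition cross (u w : pt) : R := u.1 * w.2 - u.2 * w.1.
Definition enorm (u : pt) : R := Num.sqrt (dotp u u).
Definition eucl_dist (p q : pt) : R := enorm (vsub p q).

Definition seg (a b : pt) : set pt :=
  [set p | exists t : R, 0 <= t <= 1 /\
     p = (a.1 + t * (b.1 - a.1), a.2 + t * (b.2 - a.2))].

Definition raypt (p : pt) (th t : R) : pt :=
  (p.1 + t * cos th, p.2 + t * sin th).

Definition ccw_angle (u w : pt) : R :=
  let a := acos (dotp u w / (enorm u * enorm w)) in
  if 0 <= cross u w then a else 2 * pi - a.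

Section Polygon.
Variables (n : nat) (v : nat -> pt).

Definition vtx (i : nat) : pt := v (i %% n)%N.
Definition edge (i : nat) : set pt := seg (vtx i) (vtx i.+1).
Definition edge_len (i : nat) : R := eucl_dist (vtx i.+1) (vtx i).
Definition perimeter : R := \sum_(i < n) edge_len i.
Definition edges_union : set pt := [set p | exists2 i, (i < n)%N & edge i p].

Definition simple_polygon : Prop :=
  (3 <= n)%N /\
  (forall i, (i < n)%N -> vtx i <> vtx i.+1) /\
  (forall i j p, (i < n)%N -> (j < n)%N -> i <> j -> edge i p -> edge j p ->
     (j = (i.+1 %% n)%N /\ p = vtx i.+1) \/ (i = (j.+1 %% n)%N /\ p = vtx j.+1)).

Definition polygon_region (T : set pt) : Prop :=
  compact T /\ interior T !=set0 /\ closure T `\` interior T = edges_union.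

(* twice the signed (shoelace) area: > 0 iff the vertices are ccw *)
Definition shoelace : R := \sum_(i < n) cross (vtx i) (vtx i.+1).

(* inner angle phi_i between edge i and edge i+1 (at vertex i+1) *)
Definition inner_angle (i : nat) : R :=
  let a := ccw_angle (vsub (vtx i.+2) (vtx i.+1)) (vsub (vtx i) (vtx i.+1)) in
  if 0 < shoelace then a else 2 * pi - a.

Definition outer_side (i : nat) (p : pt) : Prop :=
  if 0 < shoelace then cross (vsub (vtx i.+1) (vtx i)) (vsub p (vtx i)) < 0
  else 0 < cross (vsub (vtx i.+1) (vtx i)) (vsub p (vtx i)).

(* the infinite closed sector at vertex i+1 bounded by the (half-lines
   carrying) edges i and i+1, of opening inner_angle i, on the side of T:
   the "local model" of T at that vertex *)
Definition vertex_sector (i : nat) : set pt :=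
  let c := vtx i.+1 in
  let s := if 0 < shoelace then vsub (vtx i.+2) (vtx i.+1)
           else vsub (vtx i) (vtx i.+1) in
  [set q | exists rho psi : R, 0 <= rho /\ 0 <= psi <= inner_angle i /\
     q = (c.1 + rho * (cos psi * s.1 - sin psi * s.2),
          c.2 + rho * (cos psi * s.2 + sin psi * s.1))].

Definition detect_set (T : set pt) (i : nat) (r : R) : set cfg :=
  [set c | 0 <= c.2 < 2 * pi /\ ~ T c.1 /\
     exists t, 0 <= t <= r /\ edge i (raypt c.1 c.2 t) /\
       forall t', 0 <= t' < t -> ~ T (raypt c.1 c.2 t')].

Definition naive_set (i : nat) (r : R) : set cfg :=
  [set c | 0 <= c.2 < 2 * pi /\ outer_side i c.1 /\
     exists t, 0 <= t <= r /\ edge i (raypt c.1 c.2 t)].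

(* configurations of the naive set of edge i obstructed by the local model
   of T at vertex k+1 (k = i: far end of edge i; k = i-1: near end) *)
Definition blocked_set (i k : nat) (r : R) : set cfg :=
  [set c | naive_set i r c /\
     exists t, 0 <= t <= r /\ edge i (raypt c.1 c.2 t) /\
       exists t', 0 <= t' < t /\ vertex_sector k (raypt c.1 c.2 t')].

(* Modelling assumption of the paper: the detection set of each edge is
   obstructed only at its two vertices, by the adjacent edges, each vertex
   acting independently (interference from non-adjacent edges neglected). *)
Definition adjacent_only_obstruction (T : set pt) (r : R) : Prop :=
  forall i, (i < n)%N ->
    leb3 (detect_set T i r) =
      (leb3 (naive_set i r) - leb3 (blocked_set i (i + n.-1)%N r)
       - leb3 (blocked_set i i r))%E.

End Polygon.

(* event {s <= r}: sensor in Omega, direction in [0,2pi), and the ray meets T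
   within distance r (the minimum defining s then exists and is <= r) *)
Definition hit_event (Omega T : set pt) (r : R) : set cfg :=
  [set c | Omega c.1 /\ 0 <= c.2 < 2 * pi /\
     exists t, 0 <= t <= r /\ T (raypt c.1 c.2 t)].

(* probability for (x,y) uniform on Omega, theta uniform on [0,2pi), indep. *)
Definition sensor_prob (Omega T : set pt) (r : R) : R :=
  fine (leb3 (hit_event Omega T r)) / fine (leb3 (Omega `*` `[0, 2 * pi[%classic)).

Definition indic (b : bool) : R := if b then 1 else 0.
Definition pos_part (t : R) : R := Num.max t 0.

Definition C1 (phi l r : R) : bool :=
  (3 * pi / 2 < phi) && (phi < 2 * pi) && (r < l * `|sin phi|).
Definition C2 (phi l r : R) : bool :=
  (pi < phi) && (phi <= 3 * pi / 2) && (r < l).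
Definition C3 (phi l r : R) : bool :=
  (3 * pi / 2 < phi) && (phi < 2 * pi) && (l * `|sin phi| <= r).
Definition C4 (phi l r : R) : bool :=
  (pi < phi) && (phi <= 3 * pi / 2) && (l <= r).
Definition C12 (phi l r : R) : bool := C1 phi l r || C2 phi l r.

Definition g1 (phi : R) : R := -2 + 2 * (phi - pi) / tan phi.
Definition g12 (phi l r : R) : R := - r ^+ 2 * g1 phi / 8.
Definition gam (phi l r : R) : R := l * sin (2 * pi - phi) / r.
Definition zeta1 (phi l r : R) : R := phi - pi - asin (gam phi l r).
Definition zeta2 (phi l r : R) : R := phi - pi - (pi - asin (gam phi l r)).
Definition g31 (phi l r : R) : R :=
  let y := gam phi l r in
  - 2 * y ^+ 2 + (tan phi)^-1 * (2 * asin y - 2 * y * Num.sqrt (1 - y ^+ 2)).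
Definition g32 (phi l r : R) : R :=
  let y := gam phi l r in
  (tan phi)^-1 * (- 2 * (- asin y - phi + 2 * pi) - 2 * y * Num.sqrt (1 - y ^+ 2)
                  - sin (2 * phi))
  - 1 + 2 * y ^+ 2 + cos (2 * phi).
Definition g33 (phi l r : R) : R :=
  l ^+ 2 * sin phi / 2 *
    (zeta1 phi l r * cos phi - sin phi * (ln `|sin phi| - ln (gam phi l r))).
Definition g34 (phi l r : R) : R :=
  l ^+ 2 * sin phi / 2 * (pi - 2 * asin (gam phi l r)) * cos phi.
Definition g3 (phi l r : R) : R :=
  l * r * (cos (pos_part (zeta2 phi l r)) - cos (zeta1 phi l r))
  - r ^+ 2 / 8 * g31 phi l r
  + (- r ^+ 2 / 8 * g32 phi l r + g34 phi l r) * indic (0 < zeta2 phi l r)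
  + g33 phi l r * indic (zeta2 phi l r <= 0).
Definition g4 (phi l r : R) : R :=
  l * r * (1 - cos (zeta1 phi l r)) - r ^+ 2 / 8 * g31 phi l r + g33 phi l r.

Definition corr (phi l r : R) : R :=
  indic (C12 phi l r) * g12 phi l r + indic (C3 phi l r) * g3 phi l r
  + indic (C4 phi l r) * g4 phi l r.

End Sensor.

(* Main.v *)
(* A ray hitting T from outside first meets T at a boundary point, hence on an edge;
   ties occur only for rays through a vertex, a null set. So the hit event has measure
   2 pi |T| plus the measures of the detection sets of the edges, which by assumption
   are the unobstructed measure 2 l r minus one obstruction term per end vertex.
   Slicing by the direction of sight and writing the position as (edge point) minus
   t times the direction turns an obstruction term at a reflex vertex of angle phi into
     int_0^(phi - pi) sin a * int_0^l max (0, r - u sin phi / sin (phi - a)) du da,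
   because the complement of the sector is a convex wedge: the edge point at distance u
   from the vertex is seen freely exactly from inside the wedge. The inner integral is
   elementary and changes form when sin (a - phi) = gam; the outer one has an explicit
   antiderivative in each regime, and the regimes are separated by zeta1 and zeta2. *)

Require Import Defs.
From HB Require Import structures.
From mathcomp Require Import all_boot all_order all_algebra.
From mathcomp Require Import all_classical all_reals all_analysis.
From mathcomp Require Import measurable_realfun ring lra.
Import Order.TTheory GRing.Theory Num.Theory.
Import numFieldNormedType.Exports.
Local Open Scope classical_set_scope.
Local Open Scope ring_scope.
Set Implicit Arguments. Unset Strict Implicit. Unset Printing Implicit Defensive.

(** * Affine maps and plane Lebesgue measure *)

(** Once the direction of sight is frozen, every change of variables is affine, so scaling on the
    line and Tonelli suffice. The edge parameter is normalised to [0, 1]; the length of the edge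
    enters through the determinant [l * sin (w - th)]. An edge has two ends and a polygon two
    orientations. A base direction [w] and a sign [sg] reduce the four cases to one wedge, at the
    price of an angle [sg * (w - th)] that runs over another window than [0, 2 pi); periodicity
    repairs this. Additivity over the edges requires measurable detection sets, although a first hit
    constrains a continuum of earlier times; compactness reduces it to countably many conditions.
    The obstruction hypothesis subtracts the measures of the two blocked sets of an edge separately,
    so these sets are never compared with each other. *)

Ltac measurable_poly := repeat first
  [ done | apply: measurable_funB | apply: measurable_funD | apply: measurable_funM ].

Section measure.
Variable R : realType.
Local Notation mu := (@lebesgue_measure R).

Lemma measurable_preimageT d1 d2 (T1 : measurableType d1) (T2 : measurableType d2)
  (f : T1 -> T2) (A : set T2) :
  measurable_fun setT f -> measurable A -> measurable (f @^-1` A).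
Proof. by move=> mf mA; rewrite -[X in measurable X]setTI; exact: mf. Qed.

Definition affine (b k t : R) : R := b + k * t.

Lemma measurable_affine (b k : R) :
  measurable_fun setT (affine b k : measurableTypeR R -> measurableTypeR R).
Proof. by apply: measurable_funD => //; apply: measurable_funM. Qed.

HB.instance Definition _ (b k : R) := isMeasurableFun.Build _ _ _ _
  (affine b k : measurableTypeR R -> measurableTypeR R) (measurable_affine b k).

Lemma affine_preimage_oc (b k x y : R) : k != 0 ->
  (`|k|%:E * mu (affine b k @^-1` `]x, y]) = mu `]x, y])%E.
Proof.
move=> k0; have [kp|kn] := ltP 0 k.
  have -> : affine b k @^-1` `]x, y] = `](x - b) / k, (y - b) / k]%classic.
    apply/seteqP; split => t /=; rewrite /affine !in_itv/= ltr_pdivrMr// ler_pdivlMr//;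
      move=> /andP[h1 h2]; apply/andP; split; lra.
  rewrite !lebesgue_measure_itv/= !lte_fin ltr_pM2r ?invr_gt0// ltrD2r.
  case: ifP => _; last by rewrite mule0.
  by rewrite gtr0_norm// -!EFinB -EFinM; congr (_%:E); field.
have {}kn : k < 0 by rewrite lt_neqAle k0.
have -> : affine b k @^-1` `]x, y] = `[(y - b) / k, (x - b) / k[%classic.
  apply/seteqP; split => t /=; rewrite /affine !in_itv/= ltr_ndivlMr// ler_ndivrMr//;
    move=> /andP[h1 h2]; apply/andP; split; lra.
rewrite !lebesgue_measure_itv/= !lte_fin ltr_nM2r ?invr_lt0// ltrD2r.
case: ifP => _; last by rewrite mule0.
by rewrite ltr0_norm// -!EFinB -EFinM; congr (_%:E); field.
Qed.

(** The right-hand side is a measure in [A] giving each interval []x, y]] its length, and this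
    characterises Lebesgue measure. *)
Lemma lebesgue_measure_affine (b k : R) (A : set R) : k != 0 -> measurable A ->
  mu A = (`|k|%:E * mu (affine b k @^-1` A))%E.
Proof.
move=> k0 mA.
rewrite (@lebesgue_measure_unique R (mscale (NngNum (normr_ge0 k))
  (pushforward mu (affine b k : measurableTypeR R -> measurableTypeR R))))//.
by move=> _ [[x y]] _ <-; rewrite -(affine_preimage_oc b x y k0).
Qed.

Lemma product_measure12 d1 d2 (T1 : measurableType d1) (T2 : measurableType d2)
  (m1 : {sigma_finite_measure set T1 -> \bar R})
  (m2 : {sigma_finite_measure set T2 -> \bar R}) (A : set (T1 * T2)) :
  measurable A -> (m1 \x m2)%E A = (m1 \x^ m2)%E A.
Proof.
by apply: product_measure_unique => B C mB mC/=; rewrite product_measure2E.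
Qed.

Local Notation R1 := (measurableTypeR R).
Local Notation R2 := (measurableTypeR R * measurableTypeR R)%type.

HB.instance Definition _ := Measure.on (@leb2 R).

(** Squares of an exhausting sequence of sets of finite length exhaust the plane. The instance built
    on it lets [leb3] be sliced along either factor. *)
Lemma leb2_sigma_finite : sigma_finite setT (@leb2 R).
Proof.
have /sigma_finiteP[F [TF ndF Foo]] := sigma_finiteT mu.
exists (fun n => F n `*` F n).
  rewrite -setXTT TF predeqE => -[x y]; split.
    move=> [/= [n _ Fnx] [k _ Fky]]; exists (maxn n k) => //; split.
    - by move: x Fnx; exact/subsetPset/ndF/leq_maxl.
    - by move: y Fky; exact/subsetPset/ndF/leq_maxr.
  by move=> [n _ []/= ? ?]; split; exists n.
move=> k; have [mF Ffin] := Foo k.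
split; first exact: measurableX.
have mE := @product_measure1E _ _ R1 R1 R mu mu (F k) (F k) mF mF.
by rewrite [ltLHS]mE lte_mul_pinfty// ge0_fin_numE.
Qed.

HB.instance Definition _ := Measure_isSigmaFinite.Build _ _ _ (@leb2 R) leb2_sigma_finite.

Lemma leb2_xE (A : set R2) : leb2 A = (\int[mu]_x mu (xsection A x))%E.
Proof. by []. Qed.

Lemma leb2_yE (A : set R2) : measurable A ->
  leb2 A = (\int[mu]_y mu (ysection A y))%E.
Proof. exact: product_measure12. Qed.

Lemma leb2_affine_y (b : R -> R) (k : R) (A : set R2) : k != 0 -> measurable A ->
  measurable_fun setT (fun p : R2 => (p.1, affine (b p.1) k p.2) : R2) ->
  leb2 A = (`|k|%:E * leb2 ((fun p : R2 => (p.1, affine (b p.1) k p.2) : R2) @^-1` A))%E.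
Proof.
move=> k0 mA mf; have mB := measurable_preimageT mf mA.
rewrite !leb2_xE -ge0_integralZl//=; last exact: measurable_fun_xsection.
apply: eq_integral => x _.
rewrite (@lebesgue_measure_affine (b x) k)//=; last exact: measurable_xsection.
Qed.

Lemma leb2_affine_x (b : R -> R) (k : R) (A : set R2) : k != 0 -> measurable A ->
  measurable_fun setT (fun p : R2 => (affine (b p.2) k p.1, p.2) : R2) ->
  leb2 A = (`|k|%:E * leb2 ((fun p : R2 => (affine (b p.2) k p.1, p.2) : R2) @^-1` A))%E.
Proof.
move=> k0 mA mf; have mB := measurable_preimageT mf mA.
rewrite !leb2_yE// -ge0_integralZl//=; last exact: measurable_fun_ysection.
apply: eq_integral => x _.
rewrite (@lebesgue_measure_affine (b x) k)//=; last exact: measurable_ysection.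
Qed.

Lemma measurable_swapR : measurable_fun setT (fun p : R2 => (p.2, p.1) : R2).
Proof. exact: measurable_fun_pair. Qed.

Lemma leb2_swap (A : set R2) : measurable A ->
  leb2 ((fun p : R2 => (p.2, p.1) : R2) @^-1` A) = leb2 A.
Proof.
move=> mA; rewrite leb2_yE; last exact: (measurable_preimageT measurable_swapR).
rewrite leb2_xE; exact: eq_integral.
Qed.

Definition affine2 (a e f : R * R) (p : R2) : R2 :=
  (a.1 + p.1 * e.1 + p.2 * f.1, a.2 + p.1 * e.2 + p.2 * f.2).

Lemma measurable_affine2 a e f : measurable_fun setT (affine2 a e f).
Proof.
by apply: measurable_fun_pair; measurable_poly.
Qed.

(** A triangular factorisation: when [e.1 != 0], the map first changes only the first coordinate,
    with slope [e.1], then only the second, with slope [cross e f / e.1]. The product of the slopes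
    is the determinant. *)
Lemma leb2_affine2 (a e f : R * R) (A : set R2) : cross e f != 0 -> measurable A ->
  leb2 A = (`|cross e f|%:E * leb2 (affine2 a e f @^-1` A))%E.
Proof.
have main a' e' f' B : cross e' f' != 0 -> e'.1 != 0 -> measurable B ->
  leb2 B = (`|cross e' f'|%:E * leb2 (affine2 a' e' f' @^-1` B))%E.
  move=> c0 e0 mB.
  (* [b] and [k] arise by eliminating the first parameter between the two coordinates of the image
     point. *)
  pose b x := a'.2 + e'.2 * (x - a'.1) / e'.1.
  pose k := cross e' f' / e'.1.
  have mG : measurable_fun setT (fun p : R2 => (p.1, affine (b p.1) k p.2) : R2).
    by apply: measurable_fun_pair => //; rewrite /affine /b; measurable_poly.
  rewrite (@leb2_affine_y b k)//; last by rewrite mulf_neq0// invr_eq0.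
  have mB' := measurable_preimageT mG mB.
  pose b' t := a'.1 + t * f'.1.
  have mH : measurable_fun setT (fun p : R2 => (affine (b' p.2) e'.1 p.1, p.2) : R2).
    by apply: measurable_fun_pair => //; rewrite /affine /b'; measurable_poly.
  rewrite (@leb2_affine_x b' e'.1)//= muleA -EFinM -normrM divfK//.
  congr (_ * leb2 _)%E; rewrite -comp_preimage.
  apply: (congr1 (fun g : R2 -> R2 => g @^-1` B)); apply/funext => p.
  rewrite /affine2/= /affine /b /b' /k /cross; congr pair; first by ring.
  by field.
(* If [e.1] vanishes then [f.1] does not, and exchanging the two columns only flips the sign of the
   determinant. *)
move=> c0 mA; have [e0|e0] := eqVneq e.1 0; last exact: main.
have f0 : f.1 != 0.
  by apply: contra_neq c0 => f0; rewrite /cross e0 f0; ring.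
have cE : cross e f = - cross f e by rewrite /cross; ring.
rewrite (main a f e A)//; last by rewrite -oppr_eq0 -cE.
rewrite cE normrN; congr (_ * _)%E.
rewrite -leb2_swap; last exact: (measurable_preimageT (measurable_affine2 _ _ _)).
congr leb2; rewrite -comp_preimage.
apply: (congr1 (fun g : R2 -> R2 => g @^-1` A)); apply/funext => p.
by rewrite /affine2/=; congr pair; ring.
Qed.

Lemma integral_affine (a s : R) (D : set R) (f : R -> \bar R) : `|s| = 1 ->
  measurable D -> measurable_fun setT f -> (forall x, 0 <= f x)%E ->
  (\int[mu]_(x in D) f x = \int[mu]_(t in affine a s @^-1` D) f (affine a s t))%E.
Proof.
move=> s1 mD mf f0.
have := @ge0_integral_pushforward _ _ (measurableTypeR R) (measurableTypeR R) R
  (affine a s) (measurable_affine a s) mu D f mD (measurable_funTS mf)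
  (in1W f0).
move=> /= <-; apply: eq_measure_integral => A mA AD.
have s0 : s != 0 by rewrite -normr_eq0 s1 oner_eq0.
by have /= := lebesgue_measure_affine a s0 mA; rewrite s1 mul1e.
Qed.

Lemma ge0_integral_itv_split (a b c : R) (f : R -> \bar R) : a <= b -> b <= c ->
  measurable_fun setT f -> (forall x, 0 <= f x)%E ->
  (\int[mu]_(x in `[a, c[) f x =
   \int[mu]_(x in `[a, b[) f x + \int[mu]_(x in `[b, c[) f x)%E.
Proof.
move=> ab bc mf f0; rewrite (@itv_bndbnd_setU _ _ _ (BLeft b))//.
rewrite ge0_integral_setU//=; first exact: measurable_funTS.
apply/disj_setPLR => x /=; rewrite !in_itv/= => /andP[_ xb] /andP[bx _].
by have := lt_le_trans xb bx; rewrite ltxx.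
Qed.

Lemma integral_translate (a b c : R) (f : R -> \bar R) :
  measurable_fun setT f -> (forall x, 0 <= f x)%E ->
  (\int[mu]_(x in `[(c + a)%R, (c + b)%R[) f x = \int[mu]_(x in `[a, b[) f (c + x)%R)%E.
Proof.
move=> mf f0; rewrite (@integral_affine c 1)//; last exact: normr1.
have -> : affine c 1 @^-1` `[c + a, c + b[ = `[a, b[%classic.
  by apply/seteqP; split => x /=; rewrite /affine mul1r !in_itv/= lerD2l ltrD2l.
by apply: eq_integral => x _; rewrite /affine mul1r.
Qed.

Section periodic.
Variables (T : R) (f : R -> \bar R).
Hypotheses (T0 : 0 < T) (mf : measurable_fun setT f) (f0 : forall x, (0 <= f x)%E).
Hypothesis fT : forall x, f (x + T) = f x.

Lemma periodic_intmul (k : int) x : f (T *~ k + x) = f x.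
Proof.
have fTn n y : f (y + T *+ n) = f y.
  by elim: n => [|n IH]; [rewrite mulr0n addr0|rewrite mulrS addrCA addrC fT].
case: k => n; first by rewrite addrC fTn.
by rewrite NegzE mulrNz -[LHS](fTn n.+1) pmulrn; congr f; rewrite addrAC addNr add0r.
Qed.

(** Whole periods are shifted away, leaving a window that starts at some [x0] in [[0, T[]; its part
    past [T] is moved back to [[0, x0[]. *)
Lemma integral_period_window c :
  (\int[mu]_(x in `[c, (c + T)%R[) f x = \int[mu]_(x in `[0%R, T[) f x)%E.
Proof.
pose k := Num.floor (c / T); pose x0 := c - T *~ k.
have TE : T *~ k = T * k%:~R by rewrite -mulrzr.
have x00 : 0 <= x0.
  by rewrite subr_ge0 TE mulrC -ler_pdivlMr// floor_le.
have x0T : x0 < T.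
  have /andP[_] := floor_itv (c / T); rewrite intrD ltr_pdivrMr// /x0 TE; lra.
have -> : c + T = T *~ k + (x0 + T) by rewrite /x0; ring.
have {1}-> : c = T *~ k + x0 by rewrite /x0; ring.
rewrite integral_translate//.
under eq_integral do rewrite periodic_intmul.
rewrite (@ge0_integral_itv_split x0 T)//; [|exact: ltW|lra].
rewrite [RHS](@ge0_integral_itv_split 0 x0)//; last exact: ltW.
rewrite addeC; congr (_ + _)%E.
have -> : x0 + T = T + x0 by rewrite addrC.
have {1}-> : T = T + 0 by rewrite addr0.
rewrite integral_translate//.
by apply: eq_integral => x _; rewrite addrC fT.
Qed.

(** A reflection moves the closed end of a half-open window to the other side, so both signs are
    treated on open windows. *)
Lemma integral_periodic (a s : R) : `|s| = 1 ->
  (\int[mu]_(x in `[0%R, T[) f (affine a s x) = \int[mu]_(x in `[0%R, T[) f x)%E.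
Proof.
move=> s1; have mfa : measurable_fun setT (f \o affine a s).
  exact: (measurableT_comp mf (measurable_affine a s)).
have oo c g : measurable_fun setT g ->
    (\int[mu]_(x in `[c, (c + T)%R[) g x = \int[mu]_(x in `]c, (c + T)%R[) g x)%E.
  by move=> mg; rewrite (@integral_itv_bndoo _ _ _ g)//; exact: measurable_funTS.
have -> : `[0, T[%classic = `[0, 0 + T[%classic by rewrite add0r.
rewrite oo//=.
have /orP[/eqP ->|/eqP ->] : (s == 1) || (s == -1).
  by have := eqr_norml s 1; rewrite s1 eqxx ler01 andbT => <-.
- rewrite add0r -(integral_period_window a) (oo a)// (@integral_affine a 1)// ?normr1//.
  congr integral; apply/seteqP; split => x /=; rewrite /affine !in_itv/=; lra.
- rewrite add0r -(integral_period_window (a - T)) oo// (@integral_affine a (-1))//; last first.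
    by rewrite normrN1.
  congr integral; apply/seteqP; split => x /=; rewrite /affine !in_itv/=; lra.
Qed.

End periodic.

End measure.

(** * Measurability of hitting sets *)

Section topology.
Variable R : realType.
Local Notation R1 := (measurableTypeR R).
Local Notation R2 := (R1 * R1)%type.
Local Notation R3 := (R2 * R1)%type.

(** An open set is the union of the rational boxes it contains, and these are countably many. This
    links the topology of configurations with the product sigma-algebra of [leb3]. *)
Lemma open_measurable3 (A : set (cfg R)) : open A -> @measurable _ R3 A.
Proof.
move=> oA.
pose I := (rat * rat * rat * rat)%type.
pose box (i : I) : set R3 :=
  (ball (ratr i.1.1.1 : R) (ratr i.2) `*` ball (ratr i.1.1.2 : R) (ratr i.2))
  `*` ball (ratr i.1.2 : R) (ratr i.2).
have -> : A = \bigcup_(i : I) (if `[< box i `<=` A >] then box i else set0).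
  apply/seteqP; split => [p Ap|p [i _]]; last by case: ifPn => // /asboolP; exact.
  have /nbhs_ballP[e /= e0 peA] : nbhs p A by exact: open_nbhs_nbhs.
  (* The radius stays below [e / 2] because the triangle inequality passes through the rational
     centre. *)
  have [q] := rat_in_itvoo (divr_gt0 e0 (ltr0Sn R 1)).
  rewrite in_itv/= => /andP[q0 qe].
  have near_rat (x : R) : exists s : rat, `|ratr s - x| < ratr q.
    have [|s] := @rat_in_itvoo R (x - ratr q) (x + ratr q); first by lra.
    rewrite in_itv/= => /andP[s1 s2].
    by exists s; rewrite ltr_norml; lra.
  have [s1 h1] := near_rat p.1.1; have [s2 h2] := near_rat p.1.2.
  have [s3 h3] := near_rat p.2.
  exists (s1, s2, s3, q) => //; case: ifPn => [_|/asboolP[]].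
    by split; [split|]; rewrite /= -ball_normE /ball_/=.
  move=> p' [[]]; rewrite /= -!ball_normE /ball_/= => g1 g2 g3; apply: peA.
  have tri (a b c : R) : `|a - b| < ratr q -> `|a - c| < ratr q -> `|b - c| < e.
    rewrite !ltr_norml => /andP[? ?] /andP[? ?]; apply/andP; split; lra.
  split; [split|]; rewrite -ball_normE /ball_/=.
  - exact: tri h1 g1.
  - exact: tri h2 g2.
  - exact: tri h3 g3.
apply: countable_bigcupT_measurable; first exact: countableP.
move=> i; case: ifPn => // _.
by apply: measurableX; [apply: measurableX|]; exact: measurable_ball.
Qed.

Lemma closed_measurable3 (A : set (cfg R)) : closed A -> @measurable _ R3 A.
Proof. by move/closed_openC/open_measurable3/measurableC; rewrite setCK. Qed.

(** The cylinder over [A] is closed in the configuration space, and [A] is one of its sections. *)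
Lemma closed_measurable2 (A : set (pt R)) : closed A -> @measurable _ R2 A.
Proof.
move=> cA; have mA : @measurable _ R3 (fst @^-1` A).
  apply: closed_measurable3; apply: preimage_closed => // x _; exact: cvg_fst.
have -> : A = ysection (fst @^-1` A : set R3) 0; last exact: measurable_ysection.
by apply/seteqP; split => x; rewrite /ysection/= inE.
Qed.

Definition hits (S : set (pt R)) (q : R) : set (cfg R) :=
  [set c | exists t : R, 0 <= t <= q /\ S (raypt c.1 c.2 t)].

Lemma continuous_raypt : continuous (fun z : R * cfg R => raypt z.2.1 z.2.2 z.1).
Proof.
move=> z; have cf (u : R * cfg R -> R) (h : R -> R) :
    u @ z --> u z -> continuous h -> (h \o u) x @[x --> z] --> (h \o u) z.
  by move=> cu ch; apply: (cvg_comp _ _ cu); exact: ch.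
have c2 : (fun z : R * cfg R => z.2.2) x @[x --> z] --> z.2.2.
  by apply: (cvg_comp _ _ cvg_snd); exact: cvg_snd.
have c21 : (fun z : R * cfg R => z.2.1) x @[x --> z] --> z.2.1.
  by apply: (cvg_comp _ _ cvg_snd); exact: cvg_fst.
have c11 : (fun z : R * cfg R => z.2.1.1) x @[x --> z] --> z.2.1.1.
  by apply: (cvg_comp _ _ c21); exact: cvg_fst.
have c12 : (fun z : R * cfg R => z.2.1.2) x @[x --> z] --> z.2.1.2.
  by apply: (cvg_comp _ _ c21); exact: cvg_snd.
have c1 : (fun z : R * cfg R => z.1) x @[x --> z] --> z.1 by exact: cvg_fst.
exact: (cvg_pair (cvgD c11 (cvgM c1 (cf _ _ c2 (@continuous_cos R))))
                 (cvgD c12 (cvgM c1 (cf _ _ c2 (@continuous_sin R))))).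
Qed.

(** The tube lemma: missing [S] is an open condition on time and configuration, and it holds
    uniformly over the compact range [[0, q]]. *)
Lemma closed_hits (S : set (pt R)) q : closed S -> closed (hits S q).
Proof.
move=> cS; rewrite -openC openE => c nc.
have /compact_near_coveringP cov := @segment_compact R 0 q.
have /cov : forall t, `[0, q]%classic t -> \forall t' \near t & c' \near nbhs c,
    ~ S (raypt c'.1 c'.2 t').
  move=> t; rewrite /= in_itv/= => tq.
  have [[U V] /= [Ut Vc] UV] : nbhs (t, c)
      [set z : R * cfg R | ~ S (raypt z.2.1 z.2.2 z.1)].
    apply: (@continuous_raypt (t, c) (~` S)) => /=.
    apply: open_nbhs_nbhs; split; first exact: closed_openC.
    by move=> St; apply: nc; exists t.
  by exists (U, V) => // -[t' c'] /= [Ut' Vc']; exact: (UV (t', c')).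
apply: filterS => c' h [t [tq St]]; exact: (h t).
Qed.

Lemma first_hit (S : set (pt R)) q c : closed S -> hits S q c ->
  exists t, [/\ 0 <= t <= q, S (raypt c.1 c.2 t) &
    forall t', 0 <= t' < t -> ~ S (raypt c.1 c.2 t')].
Proof.
move=> cS [t1 [t1q St1]].
pose B := `[0, q]%classic `&` [set t | S (raypt c.1 c.2 t)].
have cB : compact B.
  apply: compact_closedI; first exact: segment_compact.
  apply: (@preimage_closed _ _ (fun t => raypt c.1 c.2 t)) => // t _.
  have tc : (fun t' : R => (t', c)) x @[x --> t] --> (t, c).
    exact: (cvg_pair cvg_id (cvg_cst c)).
  exact: (cvg_comp _ _ tc (@continuous_raypt (t, c))).
have B0 : B !=set0 by exists t1; split => //=; rewrite in_itv.
have [] := @compact_EVT_min _ R id B B0 cB.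
  by apply: continuous_subspaceT => x; exact: cvg_id.
move=> t /[!inE] -[/= /[!in_itv]/= tq St] tmin; exists t; split => // t' /andP[t'0 t't] St'.
have /[!inE] := tmin t'; rewrite leNgt t't => /(_ _)/negP; apply => //.
by split => //=; rewrite in_itv/= t'0; case/andP: tq => _; exact/le_trans/ltW.
Qed.
Lemma closed_seg (a b : pt R) : closed (seg a b).
Proof.
apply: compact_closed; first exact: norm_hausdorff.
pose f (t : R) : pt R := (a.1 + t * (b.1 - a.1), a.2 + t * (b.2 - a.2)).
have -> : seg a b = f @` `[0, 1]%classic.
  apply/seteqP; split => p; first by move=> [t [t01 ->]]; exists t => //=; rewrite in_itv.
  by move=> [t /=]; rewrite in_itv/= => t01 <-; exists t.
apply: continuous_compact; last exact: segment_compact.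
apply: continuous_subspaceT => t.
have cl (x y : R) : (fun t : R => x + t * y) u @[u --> t] --> x + t * y.
  by apply: cvgD; [exact: cvg_cst|apply: cvgM; [exact: cvg_id|exact: cvg_cst]].
exact: (cvg_pair (cl _ _) (cl _ _)).
Qed.

Lemma measurable_hits (S : set (pt R)) q : closed S -> @measurable _ R3 (hits S q).
Proof. by move=> cS; apply: closed_measurable3; exact: closed_hits. Qed.

Lemma measurable_gt0 d (T : measurableType d) (f : T -> R) :
  measurable_fun setT f -> measurable [set x | 0 < f x].
Proof.
move=> mf; have -> : [set x | 0 < f x] = f @^-1` `]0, +oo[.
  by apply/seteqP; split => x /=; rewrite in_itv/= andbT.
by rewrite -[X in measurable X]setTI; exact: mf.
Qed.

Lemma measurable_ge0 d (T : measurableType d) (f : T -> R) :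
  measurable_fun setT f -> measurable [set x | 0 <= f x].
Proof.
move=> mf; have -> : [set x | 0 <= f x] = f @^-1` `[0, +oo[.
  by apply/seteqP; split => x /=; rewrite in_itv/= andbT.
by rewrite -[X in measurable X]setTI; exact: mf.
Qed.

Definition angles : set (cfg R) := setT `*` `[0, 2 * pi[%classic.

Lemma measurable_angles : @measurable _ R3 angles.
Proof. by apply: measurableX. Qed.

Lemma anglesE (c : cfg R) : angles c <-> 0 <= c.2 < 2 * pi.
Proof. by rewrite /angles/= in_itv/=; split => [[]|]. Qed.

(* Membership in the right-hand side only involves hitting within rational
   radii (and r), which is what makes it measurable. *)
Lemma detect_setE n (v : nat -> pt R) (T : set (pt R)) i r :
  closed T -> edge n v i `<=` T ->
  detect_set n v T i r = angles `&` (fst @^-1` (~` T)) `&` hits T r `&`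
    hits (edge n v i) r `&`
    \bigcap_(q : rat) [set c | 0 <= (ratr q : R) <= r ->
       hits T (ratr q) c -> hits (edge n v i) (ratr q) c].
Proof.
move=> cT eT; have ce : closed (edge n v i) by exact: closed_seg.
apply/seteqP; split => [c [c2 [Tc [t [tr [et h]]]]]|].
  split; [split; [split; [split|]|]|] => //.
  - by exists t; split => //; exact: eT.
  - by exists t.
  - move=> q _ /= qr [t1 [t1q Tt1]]; exists t; split => //.
    case/andP: tr => -> _ /=; rewrite leNgt; apply/negP => qt.
    case/andP: t1q => t10 t1q.
    by apply: (h t1) => //; rewrite t10 (le_lt_trans t1q).
move=> c [[[[/anglesE c2 Tc] hT] hS] hq]; split => //; split => //.
have [t0 [t0r Tt0 h0]] := first_hit cT hT.
have [ts [tsr Sts hs]] := first_hit ce hS.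
have t0s : t0 <= ts.
  rewrite leNgt; apply/negP => lt; apply: (h0 ts); last exact: eT.
  by case/andP: tsr => ->.
move: t0s; rewrite le_eqVlt => /predU1P[t0E|lt].
  by exists ts; split => //; split => //; rewrite -t0E.
(* If [T] were met strictly before the edge, a rational radius in between would reach [T] without
   reaching the edge. *)
have [q] := rat_in_itvoo lt; rewrite in_itv/= => /andP[q1 q2].
exfalso; have /= := hq q I; case; last first.
- by move=> t [/andP[tt tq] et]; apply: (hs t) => //; rewrite tt (le_lt_trans tq).
- by exists t0; split => //; case/andP: t0r => -> _; exact: ltW.
- case/andP: t0r => t00 _; case/andP: tsr => _ tsr.
  by rewrite (le_trans t00 (ltW q1)) (le_trans (ltW q2) tsr).
Qed.

Lemma measurable_fstC (T : set (pt R)) : closed T -> @measurable _ R3 (fst @^-1` (~` T)).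
Proof.
move=> cT; rewrite -[X in measurable X]setTI; apply: (@measurable_fst _ _ R2 R1) => //.
by apply: measurableC; exact: closed_measurable2.
Qed.

Lemma measurable_detect_set n (v : nat -> pt R) (T : set (pt R)) i r :
  closed T -> edge n v i `<=` T -> @measurable _ R3 (detect_set n v T i r).
Proof.
move=> cT eT; have ce : closed (edge n v i) by exact: closed_seg.
rewrite detect_setE//; apply: measurableI; last first.
  rewrite -[X in measurable X]setCK setC_bigcap; apply: measurableC.
  apply: bigcupT_measurable_rat => q.
  have [qr|qr] := boolP (0 <= ratr q <= r); last first.
    by rewrite (_ : ~` _ = set0)//; apply/seteqP; split => // c /=; apply.
  rewrite (_ : ~` _ = hits T (ratr q) `\` hits (edge n v i) (ratr q)).
    by apply: measurableD; exact: measurable_hits.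
  apply/seteqP; split => c /=; last by move=> [h1 h2] /(_ isT h1).
  by move=> /not_implyP[_ /not_implyP].
apply: measurableI; last exact: measurable_hits.
apply: measurableI; last exact: measurable_hits.
by apply: measurableI; [exact: measurable_angles|exact: measurable_fstC].
Qed.

End topology.

(** * Sectors *)

Section angles.
Variable R : realType.
Implicit Types x y : R.

Lemma sin2piB x : sin (2 * pi - x) = - sin x.
Proof. by rewrite mulr_natl addrC sinD2pi sinN. Qed.

Lemma cos2piB x : cos (2 * pi - x) = cos x.
Proof. by rewrite mulr_natl addrC cosD2pi cosN. Qed.

Lemma sin_lt0_pi x : pi < x < 2 * pi -> sin x < 0.
Proof.
move=> /andP[h1 h2]; rewrite -oppr_gt0 -sin2piB; apply: sin_gt0_pi.
by apply/andP; split; lra.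
Qed.

(** [phi] has the shape of the definition of [ccw_angle], so one statement yields both polar
    coordinates and the trigonometry of the polygon angles. *)
Lemma arg_spec (x y rho : R) : 0 < rho -> x ^+ 2 + y ^+ 2 = rho ^+ 2 ->
  let phi := if 0 <= y then acos (x / rho) else 2 * pi - acos (x / rho) in
  [/\ 0 <= phi < 2 * pi, x = rho * cos phi & y = rho * sin phi].
Proof.
move=> rho0 xy /=.
have c2 : (x / rho) ^+ 2 + (y / rho) ^+ 2 = 1.
  by rewrite !expr_div_n -mulrDl xy divff// expf_neq0 ?gt_eqF.
have c1 : -1 <= x / rho <= 1 by apply/andP; split; nra.
have sE : sin (acos (x / rho)) = `|y| / rho.
  rewrite sin_acos// -c2 addrAC subrr add0r sqrtr_sqr normrM.
  by rewrite [X in _ * X]gtr0_norm ?invr_gt0.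
have cE : cos (acos (x / rho)) = x / rho by rewrite acosK// in_itv.
have a0 := acos_ge0 c1; have api := acos_lepi c1; have pi0 := pi_gt0 R.
case: ifPn => [y0|]; last rewrite -ltNge => y0.
  split; [lra|by rewrite cE mulrC divfK// gt_eqF|].
  by rewrite sE ger0_norm// mulrC divfK// gt_eqF.
rewrite cos2piB sin2piB cE sE ltr0_norm//; split.
(* A negative [y] excludes the value 0 of [acos], which would give the angle 2 pi. *)
- have : acos (x / rho) != 0.
    apply: contraTneq y0 => a00; move: sE; rewrite a00 sin0 => /esym/eqP.
    rewrite mulf_eq0 invr_eq0 (gt_eqF rho0) orbF normr_eq0 => /eqP ->.
    by rewrite ltxx.
  move=> an0; have : 0 < acos (x / rho) by rewrite lt_neqAle eq_sym an0.
  by lra.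
- by rewrite mulrC divfK// gt_eqF.
- by field; rewrite gt_eqF.
Qed.

Lemma polar_exists (x y : R) : exists rho phi,
  [/\ 0 <= rho, 0 <= phi < 2 * pi, x = rho * cos phi & y = rho * sin phi].
Proof.
have [xy|xy] := eqVneq (x ^+ 2 + y ^+ 2) 0.
  exists 0, 0; have pi0 := pi_gt0 R.
  by split; rewrite ?lexx ?mul0r//=; [lra|nra|nra].
have rho0 : 0 < Num.sqrt (x ^+ 2 + y ^+ 2) by rewrite sqrtr_gt0 lt_neqAle eq_sym xy; nra.
exists (Num.sqrt (x ^+ 2 + y ^+ 2)); eexists.
have := @arg_spec x y _ rho0; rewrite sqr_sqrtr; last by nra.
by move=> /(_ erefl)[h1 h2 h3]; split; [exact: ltW|exact: h1|exact: h2|exact: h3].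
Qed.

End angles.

Section local_model.
Variable R : realType.
Variables (P : pt R) (w sg phi : R).
Hypothesis sg2 : sg ^+ 2 = 1.

Definition dir (x : R) : pt R := (cos x, sin x).

Lemma cross_dir x y : cross (dir x) (dir y) = sin (y - x).
Proof. by rewrite /cross /dir/= sinB; ring. Qed.

Lemma sg_cases : sg = 1 \/ sg = -1.
Proof.
have : (sg - 1) * (sg + 1) == 0 by apply/eqP; have := sg2; lra.
by rewrite mulf_eq0 subr_eq0 addr_eq0 => /orP[]/eqP; auto.
Qed.

Lemma sg_norm : `|sg| = 1.
Proof. by case: sg_cases => ->; rewrite ?normrN normr1. Qed.

Lemma sin_sgM x : sin (sg * x) = sg * sin x.
Proof. by case: sg_cases => ->; rewrite ?mulN1r ?sinN// !mul1r. Qed.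

(* [P] is the vertex, [w] the direction of the edge leaving it, and [sg] = 1 or -1
   tells whether the free wedge lies counterclockwise or clockwise of the edge. *)
Definition sector : set (pt R) := [set q | exists rho psi : R, [/\ 0 <= rho, 0 <= psi <= phi &
  q = (P.1 + rho * (dir (w - sg * psi)).1, P.2 + rho * (dir (w - sg * psi)).2)]].

(** Signed distance to the line of the edge, positive on the side of the free wedge. *)
Definition height (q : pt R) := sg * cross (dir w) (vsub q P).
(** Signed distance to the line of the other side of the sector; for a reflex [phi], among points of
    positive height, it is positive exactly in the free wedge. *)
Definition beyond (q : pt R) := sg * cross (vsub q P) (dir (w - sg * phi)).

Lemma height_polar rho psi :
  height (P.1 + rho * (dir (w - sg * psi)).1, P.2 + rho * (dir (w - sg * psi)).2)
  = - rho * sin psi.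
Proof.
have -> : - rho * sin psi = rho * (sg * sin (- (sg * psi))).
  by rewrite sinN sin_sgM -[LHS]mul1r -sg2; ring.
rewrite (_ : sin (- (sg * psi)) = sin ((w - sg * psi) - w)); last by congr sin; ring.
by rewrite -cross_dir /height /cross /vsub /dir/=; ring.
Qed.

Lemma beyond_polar rho psi :
  beyond (P.1 + rho * (dir (w - sg * psi)).1, P.2 + rho * (dir (w - sg * psi)).2)
  = rho * sin (psi - phi).
Proof.
have -> : rho * sin (psi - phi) = rho * (sg * sin (sg * (psi - phi))).
  by rewrite sin_sgM -[LHS]mul1r -sg2; ring.
have -> : sg * (psi - phi) = (w - sg * phi) - (w - sg * psi) by ring.
by rewrite -cross_dir /beyond /cross /vsub /dir/=; ring.
Qed.

Lemma polar_at (q : pt R) : exists rho psi : R, [/\ 0 <= rho, 0 <= psi < 2 * pi &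
  q = (P.1 + rho * (dir (w - sg * psi)).1, P.2 + rho * (dir (w - sg * psi)).2)].
Proof.
have [rho [psi [rho0 psi0 h1 h2]]] :=
  polar_exists (dotp (dir w) (vsub q P)) (- height q).
exists rho, psi; split => //.
have cs := cos2Dsin2 w.
have c1 : cos (w - sg * psi) = cos w * cos psi + sg * sin w * sin psi.
  by rewrite cosB sin_sgM; case: sg_cases => ->; rewrite ?mulN1r ?cosN ?mul1r; ring.
have c2 : sin (w - sg * psi) = sin w * cos psi - sg * cos w * sin psi.
  by rewrite sinB sin_sgM; case: sg_cases => ->; rewrite ?mulN1r ?cosN ?mul1r; ring.
have e1 : rho * (dir (w - sg * psi)).1 =
    cos w * (rho * cos psi) + sg * sin w * (rho * sin psi).
  by rewrite /= c1; ring.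
have e2 : rho * (dir (w - sg * psi)).2 =
    sin w * (rho * cos psi) - sg * cos w * (rho * sin psi).
  by rewrite /= c2; ring.
rewrite e1 e2 -h1 -h2 /height /dotp /cross /vsub/=; case: q {h1 h2} => x y /=.
congr pair.
- transitivity (P.1 + (cos w ^+ 2 + sg ^+ 2 * sin w ^+ 2) * (x - P.1)
    + (1 - sg ^+ 2) * (cos w * sin w * (y - P.2))); last by ring.
  by rewrite sg2 mul1r cs; ring.
- transitivity (P.2 + (sin w ^+ 2 + sg ^+ 2 * cos w ^+ 2) * (y - P.2)
    + (1 - sg ^+ 2) * (cos w * sin w * (x - P.1))); last by ring.
  by rewrite sg2 mul1r addrC [sin w ^+ 2 + _]addrC cs; ring.
Qed.

(** This is why a convex vertex needs no correction: its local model never enters the side from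
    which the edge is seen. *)
Lemma sector_convex q : phi <= pi -> sector q -> height q <= 0.
Proof.
move=> phipi [rho [psi [rho0 /andP[psi0 psiphi] ->]]]; rewrite height_polar.
have : 0 <= sin psi by apply: sin_ge0_pi; rewrite psi0 (le_trans psiphi).
by nra.
Qed.

(** Positive height puts the polar angle [psi] in (pi, 2 pi), less than pi away from [phi]; the sign
    of [sin (psi - phi)] then decides whether [psi <= phi]. *)
Lemma sector_reflex q : pi < phi < 2 * pi -> 0 < height q ->
  (sector q <-> beyond q <= 0).
Proof.
move=> /andP[phi1 phi2] H; split.
  move: H => /[swap] -[rho [psi [rho0 /andP[psi0 psiphi] ->]]].
  rewrite height_polar beyond_polar => h.
  have psi1 : pi < psi.
    rewrite ltNge; apply/negP => psipi.
    have : 0 <= sin psi by apply: sin_ge0_pi; rewrite psi0.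
    by nra.
  have : 0 <= sin (phi - psi) by apply: sin_ge0_pi; apply/andP; split; lra.
  by rewrite -opprB sinN; nra.
have [rho [psi [rho0 /andP[psi0 psi2] qE]]] := polar_at q.
move: H; rewrite qE height_polar beyond_polar => h b.
have psi1 : pi < psi.
  rewrite ltNge; apply/negP => psipi.
  have : 0 <= sin psi by apply: sin_ge0_pi; rewrite psi0.
  by nra.
exists rho, psi; split => //; rewrite psi0/= leNgt; apply/negP => phipsi.
have : 0 < sin (psi - phi) by apply: sin_gt0_pi; apply/andP; split; lra.
move: h; have [->|rhon0] := eqVneq rho 0; first by rewrite oppr0 mul0r ltxx.
have : 0 < rho by rewrite lt_neqAle eq_sym rhon0.
by nra.
Qed.

End local_model.

(** * Slicing by the direction of sight *)

Section edge_model.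
Variable R : realType.
Local Notation mu := (@lebesgue_measure R).
Local Notation R1 := (measurableTypeR R).
Local Notation R2 := (R1 * R1)%type.
Local Notation R3 := (R2 * R1)%type.
Variables (P : pt R) (w l sg r : R).
Hypotheses (sg2 : sg ^+ 2 = 1) (l0 : 0 < l) (r0 : 0 < r).

Lemma leb3_yE (A : set R3) : measurable A ->
  leb3 A = (\int[mu]_th leb2 (ysection A th))%E.
Proof.
exact: (@product_measure12 R _ _ R2 R1 (@leb2 R) mu).
Qed.

Definition edge_pt (u : R) : pt R := (P.1 + u * (l * cos w), P.2 + u * (l * sin w)).

Definition facing : set (cfg R) := [set c | [/\ 0 <= c.2 < 2 * pi, 0 < height P w sg c.1 &
  exists t u : R, [/\ 0 <= t <= r, 0 <= u <= 1 & raypt c.1 c.2 t = edge_pt u]]].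

(* Position of the sensor seeing, in direction [th] at distance [z.2], the point
   of the edge with parameter [z.1]. *)
Definition ray_chart (th : R) : R2 -> R2 :=
  affine2 P (l * cos w, l * sin w) (- cos th, - sin th).

Lemma cross_ray_chart th :
  cross (l * cos w, l * sin w) (- cos th, - sin th) = l * sin (w - th).
Proof. by rewrite /cross/= sinB; ring. Qed.

Lemma height_ray_chart th u t :
  height P w sg (ray_chart th (u, t)) = t * (sg * sin (w - th)).
Proof. by rewrite /height /ray_chart /affine2 /cross /vsub /dir/= sinB; ring. Qed.

Lemma raypt_ray_chart th u t t' :
  raypt (ray_chart th (u, t)) th t' = ray_chart th (u, t - t').
Proof. by rewrite /raypt /ray_chart /affine2/=; congr pair; ring. Qed.

Lemma ray_chart_inj th u t u' : sin (w - th) != 0 ->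
  ray_chart th (u, t) = edge_pt u' -> t = 0 /\ u = u'.
Proof.
rewrite sinB /ray_chart /edge_pt /affine2/= => s0 [h1 h2].
have a1 : (u - u') * (l * cos w) = t * cos th by lra.
have a2 : (u - u') * (l * sin w) = t * sin th by lra.
have c1 : (u - u') * l * (sin w * cos th - cos w * sin th) = 0.
  transitivity ((u - u') * (l * sin w) * cos th - (u - u') * (l * cos w) * sin th);
    first by ring.
  by rewrite a1 a2; ring.
have t0 : t * (sin w * cos th - cos w * sin th) = 0.
  transitivity ((t * cos th) * sin w - (t * sin th) * cos w); first by ring.
  by rewrite -a1 -a2; ring.
split; first by move/eqP: t0; rewrite mulf_eq0 (negbTE s0) orbF => /eqP.
move/eqP: c1; rewrite !mulf_eq0 (negbTE s0) (gt_eqF l0) !orbF subr_eq0.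
by move/eqP.
Qed.

(** In the chart, facing becomes a rectangle independent of [th]. Distance 0 is lost because the
    sensor must lie strictly outside the edge line. *)
Lemma facing_ray_chart th u t : 0 <= th < 2 * pi -> 0 < sg * sin (w - th) ->
  facing (ray_chart th (u, t), th) <-> 0 <= u <= 1 /\ 0 < t <= r.
Proof.
move=> th2 s0; have s0' : sin (w - th) != 0.
  by apply: contraTneq s0 => ->; rewrite mulr0 ltxx.
split=> [[_ /=]|[u01 /andP[t0 tr]]].
  rewrite height_ray_chart pmulr_lgt0// => t0 [t' [u' [tr u01]]].
  rewrite raypt_ray_chart => /(ray_chart_inj s0')[/eqP].
  by rewrite subr_eq0 => /eqP tE ->; rewrite t0 tE; case/andP: tr => _ ->.
split => //=; first by rewrite height_ray_chart mulr_gt0.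
exists t, u; split => //; first by rewrite (ltW t0).
rewrite raypt_ray_chart subrr /ray_chart /affine2 /edge_pt/=.
by rewrite !mul0r !addr0.
Qed.

Lemma facing_angle (c : cfg R) : facing c -> 0 < sg * sin (w - c.2).
Proof.
move=> [_ h [t [u [/andP[t0 tr] u01 ptE]]]].
have : height P w sg c.1 = t * (sg * sin (w - c.2)).
  have -> : c.1 = ray_chart c.2 (u, t); last exact: height_ray_chart.
  move: ptE; case: c {h} => -[x y] th; rewrite /raypt /edge_pt /ray_chart /affine2/=.
  by move=> [h1 h2]; congr pair; lra.
move=> hE; move: h; rewrite hE => h.
by move: t0; rewrite le_eqVlt => /predU1P[t00|/pmulr_rgt0 <-//];
   move: h; rewrite -t00 mul0r ltxx.
Qed.

Lemma measurable_height : measurable_fun setT (height P w sg : R2 -> R).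
Proof. by rewrite /height /cross /vsub/=; measurable_poly. Qed.

Lemma measurable_facing : @measurable _ R3 facing.
Proof.
have -> : facing = @angles R `&` (fst @^-1` [set q | 0 < height P w sg q])
    `&` hits (seg (edge_pt 0) (edge_pt 1)) r.
  apply/seteqP; split => c.
    move=> [c2 h [t [u [tr u01 e]]]]; split; first by split => //; exact/anglesE.
    exists t; split => //; exists u; split => //; rewrite e /edge_pt/=.
    by congr pair; ring.
  move=> [[/anglesE c2 h] [t [tr [u [u01 e]]]]]; split => //; exists t, u; split => //.
  by rewrite e /edge_pt/=; congr pair; ring.
apply: measurableI; last by apply: measurable_hits; exact: closed_seg.
apply: measurableI; first exact: measurable_angles.
rewrite -[X in measurable X]setTI; apply: (@measurable_fst _ _ R2 R1) => //.
exact: (@measurable_gt0 R _ R2 (height P w sg) measurable_height).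
Qed.

Definition chart_cell (M : set (pt R)) (th : R) : set R2 :=
  [set z | [/\ 0 <= z.1 <= 1, 0 < z.2 <= r & M (ray_chart th z)]].

(** A general position condition [M] serves both uses: the whole plane gives the unobstructed
    measure, a half-plane the obstruction term. *)
Lemma leb3_facing (M : set (pt R)) : @measurable _ R2 M ->
  leb3 (facing `&` [set c | M c.1]) =
  (\int[mu]_(th in `[0%R, (2 * pi)%R[)
    if (0 < sg * sin (w - th))%R
    then (l * (sg * sin (w - th)))%:E * leb2 (chart_cell M th) else 0)%E.
Proof.
move=> mM.
have mX : @measurable _ R3 (facing `&` [set c | M c.1]).
  apply: measurableI; first exact: measurable_facing.
  rewrite -[X in measurable X]setTI.
  exact: (@measurable_fst _ _ R2 R1 measurableT M mM).
rewrite leb3_yE// [RHS]integral_mkcond; apply: eq_integral => th _.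
rewrite patchE; case: ifPn => [|]; last first.
  move=> /negP thN; rewrite (_ : ysection _ _ = set0); first exact: (measure0 (@leb2 R)).
  apply/seteqP; split => // p; rewrite /ysection/= inE => -[[/= th2 _ _] _].
  by apply: thN; rewrite inE/= in_itv.
rewrite inE/= in_itv/= => th2.
case: ifPn => [s0|/negP sN]; last first.
  rewrite (_ : ysection _ _ = set0); first exact: (measure0 (@leb2 R)).
  apply/seteqP; split => // p; rewrite /ysection/= inE => -[/facing_angle/=].
  by move/sN.
have s0' : sin (w - th) != 0.
  by apply: contraTneq s0 => ->; rewrite mulr0 ltxx.
rewrite (@leb2_affine2 R P (l * cos w, l * sin w) (- cos th, - sin th)); last 2 first.
- by rewrite cross_ray_chart mulf_neq0// gt_eqF.
- exact: measurable_ysection.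
rewrite cross_ray_chart normrM (gtr0_norm l0).
have -> : `|sin (w - th)| = sg * sin (w - th).
  by rewrite -[RHS](gtr0_norm s0) normrM (sg_norm sg2) mul1r.
congr (_ * leb2 _)%E; apply/seteqP; split => -[u t] /=; rewrite /ysection/= inE/=.
  by move=> [/(facing_ray_chart _ _ th2 s0)[? ?] ?].
by move=> [? ? ?]; split => //; apply/facing_ray_chart.
Qed.

End edge_model.

(** * The obstruction integral *)

Section calculus.
Variable R : realType.
Local Notation mu := (@lebesgue_measure R).
Local Notation R1 := (measurableTypeR R).
Local Notation R2 := (R1 * R1)%type.

Lemma is_derive_continuous (F : R -> R) (x d : R) : is_derive x 1 F d -> F @ x --> F x.
Proof.
by move=> dF; apply/differentiable_continuous/derivable1_diffP; apply: ex_derive.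
Qed.

(** The degenerate case [a = b] matters: a regime of the obstruction integral can shrink to a
    point. *)
Lemma integral_antiderivative (f F : R -> R) (a b : R) : a <= b ->
  (forall x, a <= x <= b -> f @ x --> f x) ->
  (forall x, a <= x <= b -> is_derive x 1 F (f x)) ->
  (\int[mu]_(x in `[a, b]) (f x)%:E = (F b - F a)%:E)%E.
Proof.
rewrite le_eqVlt => /predU1P[->|ab] cf dF.
  by rewrite set_itv1 integral_set1 subrr.
have Fx x : a <= x <= b -> F @ x --> F x.
  by move=> /dF; exact: is_derive_continuous.
rewrite (@continuous_FTC2 _ f F)//.
- apply: continuous_in_subspaceT => x; rewrite inE/= in_itv/=; exact: cf.
- split => [x||].
  + by rewrite in_itv/= => /andP[ax xb]; have [] := dF x; rewrite ?ltW.
  + by apply: cvg_at_right_filter; apply: Fx; rewrite lexx ltW.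
  + by apply: cvg_at_left_filter; apply: Fx; rewrite lexx ltW.
- move=> x; rewrite in_itv/= => /andP[ax xb]; rewrite derive1E.
  by have [] := dF x; rewrite ?ltW.
Qed.

Lemma integral_itv_oo_cc (f : R -> R) (a b : R) :
  (forall x, a <= x <= b -> f @ x --> f x) ->
  (\int[mu]_(x in `]a, b[) (f x)%:E = \int[mu]_(x in `[a, b]) (f x)%:E)%E.
Proof.
move=> cf; rewrite [RHS]integral_itv_bndoo//; apply/measurable_EFinP.
apply: subspace_continuous_measurable_fun => //.
apply: continuous_in_subspaceT => x; rewrite inE/= in_itv/= => /andP[ax xb].
by apply: cf; rewrite !ltW.
Qed.

(* The slice of the obstructed region: [c] is the slope of the half-line carrying
   the adjacent edge, seen in the coordinates (position on the edge, distance). *)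
Lemma leb2_trapezoid (c r : R) : 0 < c -> 0 < r ->
  leb2 [set z : R2 | [/\ 0 <= z.1 <= 1, 0 < z.2 <= r & z.1 * c <= z.2]] =
  (if c <= r then r - c / 2 else r ^+ 2 / (2 * c))%:E.
Proof.
(* [m] is the last edge parameter whose slice meets the range: past [r / c] the slanted line is
   farther than [r]. *)
move=> c0 r0; pose m := Num.min 1 (r / c).
have m0 : 0 < m by rewrite lt_min ltr01 divr_gt0.
have mc : m * c <= r by rewrite -ler_pdivlMr// ge_min lexx orbT.
rewrite leb2_xE.
transitivity (\int[mu]_(x in `[0%R, m]) (r - x * c)%:E)%E.
  rewrite [RHS]integral_mkcond; apply: eq_integral => u _; rewrite patchE.
  have xE : xsection [set z : R2 | [/\ 0 <= z.1 <= 1, 0 < z.2 <= r & z.1 * c <= z.2]] u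
     = [set t | [/\ 0 <= u <= 1, 0 < t <= r & u * c <= t]].
    by apply/seteqP; split => t; rewrite /xsection/= inE.
  rewrite xE; case: ifPn => [|/negP].
    rewrite inE/= in_itv/= => /andP[u0 um].
    have u1 : u <= 1 by rewrite (le_trans um)// ge_min lexx.
    (* At [u = 0] the strict bound [0 < t] makes the slice half-open, unlike all the others. *)
    have [uE|un0] := eqVneq u 0.
      rewrite (_ : [set t | _] = `]0, r]%classic); last first.
        apply/seteqP; split => t /=; rewrite in_itv/=; first by case.
        by move=> /andP[t0 tr]; rewrite uE; split; lra.
      by rewrite lebesgue_measure_itv/= lte_fin r0 uE mul0r subr0 oppr0 adde0.
    have up : 0 < u by rewrite lt_neqAle eq_sym un0.
    have ucr : u * c <= r by rewrite (le_trans _ mc)// ler_pM2r.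
    have uc0 : 0 < u * c by rewrite mulr_gt0.
    rewrite (_ : [set t | _] = `[u * c, r]%classic); last first.
      apply/seteqP; split => t /=; rewrite in_itv/=.
        by move=> [_ /andP[_ ->] ->].
      by move=> /andP[t0 tr]; split; lra.
    rewrite lebesgue_measure_itv/= lte_fin; case: ltP => [_|h]; first by rewrite EFinB.
    by rewrite (_ : r - u * c = 0)//; lra.
  rewrite inE/= in_itv/= => /negP um.
  rewrite (_ : [set t | _] = set0) ?measure0//.
  apply/seteqP; split => // t /= [/andP[u0 u1] /andP[t0 tr] uct].
  move/negP: um; apply; rewrite u0/= le_min u1/=.
  by rewrite ler_pdivlMr// (le_trans uct).
have -> : (\int[mu]_(x in `[0%R, m]) (r - x * c)%:E =
    ((r * m - c / 2 * m ^+ 2) - (r * 0 - c / 2 * 0 ^+ 2))%:E)%E.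
  apply: (@integral_antiderivative (fun x => r - x * c)
    (fun x => r * x - c / 2 * x ^+ 2)); first exact: ltW.
  - move=> x _; apply: cvgB; first exact: cvg_cst.
    by apply: cvgM; [exact: cvg_id|exact: cvg_cst].
  - move=> x _; apply: is_derive_eq.
    by rewrite /GRing.scale/=; field.
congr (_%:E); rewrite /m; case: (leP c r) => cr.
  rewrite min_l; first by ring.
  by rewrite ler_pdivlMr// mul1r.
rewrite min_r; first by field; rewrite gt_eqF.
by rewrite ler_pdivrMr// mul1r ltW.
Qed.

End calculus.

(** The sine increases up to [pi / 2] and is symmetric about it. The two ends of this interval
    become [zeta1] and [zeta2]. *)
Lemma le_sin_asin (R : realType) (g x : R) : 0 <= g <= 1 -> 0 <= x <= pi ->
  (g <= sin x) = (asin g <= x <= pi - asin g).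
Proof.
move=> g01 /andP[x0 xpi]; have pi0 := pi_gt0 R.
have g1 : -1 <= g <= 1 by lra.
have a0 : 0 <= asin g.
  have [->//|an] := eqVneq (asin g) 0; rewrite leNgt; apply/negP => an0.
  have : sin (asin g) < sin 0.
    by rewrite ltr_sin// in_itv/=; have := asin_geNpi2 g1; lra.
  by rewrite sin0 asinK ?in_itv//=; lra.
have a1 := asin_lepi2 g1; have sa : sin (asin g) = g by rewrite asinK// in_itv.
have mono (y : R) : 0 <= y <= pi / 2 -> (g <= sin y) = (asin g <= y).
  by move=> y0; rewrite -{1}sa leNgt ltr_sin -?leNgt// in_itv/=; lra.
have [xle|xgt] := leP x (pi / 2).
  by rewrite mono ?x0// [x <= pi - _](_ : _ = true) ?andbT//; lra.
have -> : sin x = sin (pi - x) by rewrite sinB sinpi cospi; ring.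
rewrite mono; last by lra.
by apply/idP/andP => [h|[_ h]]; [split|]; lra.
Qed.

(** * Closed form of the obstruction integral over directions *)

Section obstruction.
Variable R : realType.
Local Notation mu := (@lebesgue_measure R).
Local Notation R1 := (measurableTypeR R).
Local Notation R2 := (R1 * R1)%type.
Variables (phi l r : R).
Hypotheses (phi1 : pi < phi) (phi2 : phi < 2 * pi) (l0 : 0 < l) (r0 : 0 < r).

Let b := - sin phi.
Let S (a : R) : R := sin (a - phi).

Let b0 : 0 < b.
Proof. by rewrite oppr_gt0; apply: sin_lt0_pi; rewrite phi1. Qed.

(** The chart cell of the half-plane [beyond <= 0], which depends on the configuration only through
    the angle [a = sg * (w - th)]. *)
Definition obstructed_cell (a : R) : set R2 :=
  [set z | [/\ 0 <= z.1 <= 1, 0 < z.2 <= r & - z.1 * l * sin phi <= z.2 * sin (a - phi)]].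

Definition obstruction_density (a : R) : \bar R :=
  if 0 < sin a then ((l * sin a)%:E * leb2 (obstructed_cell a))%E else 0%E.

(* [fA] is the density where the adjacent half-line obstructs the whole edge
   within range [r], [fB] where it obstructs only the part near the vertex. *)
Let fA (a : R) : R := sin a * (l * r - l ^+ 2 * b / 2 * (S a)^-1).
Let fB (a : R) : R := r ^+ 2 / (2 * b) * (sin a * S a).
(** Writing [sin a] as [sin ((a - phi) + phi)] turns [sin a / S a] into [cos phi] plus [sin phi]
    times the logarithmic derivative of [S]. [FB] comes from the product-to-sum formula for
    [sin a * S a]. *)
Let FA (a : R) : R := - l * r * cos a - l ^+ 2 * b / 2 * (a * cos phi + sin phi * ln (S a)).
Let FB (a : R) : R := r ^+ 2 / (4 * b) * (a * cos phi - sin (2 * a - phi) / 2).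

Let continuous_S : continuous S.
Proof.
move=> x; have c : (fun a : R => a - phi) a @[a --> x] --> x - phi.
  by apply: cvgB; [exact: cvg_id|exact: cvg_cst].
exact: (cvg_comp _ _ c (@continuous_sin R (x - phi))).
Qed.

Let is_derive_S (x : R) : is_derive x 1 S (cos (x - phi)).
Proof.
have d : is_derive x 1 (fun a : R => a - phi) 1.
  by apply: is_derive_eq; rewrite subr0.
have := @is_derive1_comp R (@sin R) (fun a : R => a - phi) x _ _ (is_derive_sin _) d.
by rewrite mulr1.
Qed.

Let derive_FA (x : R) : 0 < S x -> is_derive x 1 FA (fA x).
Proof.
move=> Sx.
have dl : is_derive x 1 (@ln R \o S) ((S x)^-1 * cos (x - phi)).
  exact: (@is_derive1_comp R (@ln R) S x _ _ (is_derive1_ln Sx) (is_derive_S x)).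
have -> : FA = (fun a => - l * r * cos a -
    l ^+ 2 * b / 2 * (a * cos phi + sin phi * (@ln R \o S) a)) by [].
apply: is_derive_eq; rewrite /GRing.scale/= /fA.
have -> : sin x = S x * cos phi + cos (x - phi) * sin phi.
  by rewrite -sinD subrK.
by field; rewrite gt_eqF.
Qed.

Let derive_FB (x : R) : is_derive x 1 FB (fB x).
Proof.
have d : is_derive x 1 (fun a : R => 2 * a - phi) 2.
  by apply: is_derive_eq; rewrite /GRing.scale/= subr0 mulr1.
have ds : is_derive x 1 (@sin R \o (fun a : R => 2 * a - phi)) (cos (2 * x - phi) * 2).
  exact: (@is_derive1_comp R (@sin R) _ x _ _ (is_derive_sin _) d).
have -> : FB = (fun a => r ^+ 2 / (4 * b) *
    (a * cos phi - (@sin R \o (fun a : R => 2 * a - phi)) a / 2)) by [].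
apply: is_derive_eq; rewrite /GRing.scale/= /fB /S.
have -> : cos phi = cos x * cos (x - phi) + sin x * sin (x - phi).
  by rewrite -cosB; congr cos; ring.
have -> : cos (2 * x - phi) = cos x * cos (x - phi) - sin x * sin (x - phi).
  by rewrite -cosD; congr cos; ring.
by field; rewrite gt_eqF.
Qed.

Let cont_fA (x : R) : 0 < S x -> fA @ x --> fA x.
Proof.
move=> Sx; apply: cvgM; first exact: continuous_sin.
apply: cvgB; first exact: cvg_cst.
apply: cvgM; first exact: cvg_cst.
by apply: cvgV; [rewrite gt_eqF|exact: continuous_S].
Qed.

Let cont_fB (x : R) : fB @ x --> fB x.
Proof.
apply: cvgM; first exact: cvg_cst.
by apply: cvgM; [exact: continuous_sin|exact: continuous_S].
Qed.

(** The defining inequality then forces the edge parameter to be 0, so the cell lies on a line. *)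
Lemma leb2_obstructed_cell_le0 (a : R) : S a <= 0 -> leb2 (obstructed_cell a) = 0%E.
Proof.
move=> Sa; rewrite leb2_xE.
rewrite (_ : (\int[mu]_x _ = \int[mu]_(x in [set 0%R]) mu (xsection (obstructed_cell a) x))%E).
  by rewrite integral_set1.
rewrite [RHS]integral_mkcond; apply: eq_integral => u _; rewrite patchE.
case: ifPn => // /negP; rewrite inE/= => un0.
rewrite (_ : xsection _ _ = set0) ?measure0//.
apply/seteqP; split => // t; rewrite /xsection/= inE/= => -[/andP[u0 u1] /andP[t0 tr]].
move=> h; apply: un0; apply/eqP; rewrite eq_le u0 andbT leNgt; apply/negP => up.
have : 0 < u * l * b by rewrite !mulr_gt0.
have : 0 <= t * - S a by rewrite mulr_ge0// ?oppr_ge0// ltW.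
by rewrite /S /b /= in h *; lra.
Qed.

Lemma leb2_obstructed_cell_gt0 (a : R) : 0 < S a ->
  leb2 (obstructed_cell a) =
  (if l * b <= r * S a then r - l * b / 2 * (S a)^-1
   else r ^+ 2 * S a / (2 * (l * b)))%:E.
Proof.
move=> Sa; have c0 : 0 < l * b / S a by rewrite divr_gt0// mulr_gt0.
have -> : obstructed_cell a =
    [set z : R2 | [/\ 0 <= z.1 <= 1, 0 < z.2 <= r & z.1 * (l * b / S a) <= z.2]].
  by apply/seteqP; split => -[u t] [/= h1 h2 h3]; split => //=; move: h3;
    rewrite mulrA ler_pdivrMr// /b /S; lra.
rewrite leb2_trapezoid// ler_pdivrMr//; congr (_%:E); case: ifP => _.
  by field; rewrite gt_eqF.
by field; rewrite !gt_eqF// mulr_gt0.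
Qed.

Lemma obstruction_densityA (a : R) : 0 < sin a -> 0 < S a -> l * b <= r * S a ->
  obstruction_density a = (fA a)%:E.
Proof.
move=> sa Sa h; rewrite /obstruction_density sa leb2_obstructed_cell_gt0// h -EFinM.
by congr (_%:E); rewrite /fA; ring.
Qed.

Lemma obstruction_densityB (a : R) : 0 < sin a -> 0 < S a -> r * S a <= l * b ->
  obstruction_density a = (fB a)%:E.
Proof.
(* At equality the cell formula takes its other branch, where [fA] and [fB] agree. *)
move=> sa Sa; rewrite le_eqVlt => /predU1P[h|h].
  rewrite obstruction_densityA// ?h//; congr (_%:E); rewrite /fA /fB.
  have -> : S a = l * b / r by rewrite -h; field; rewrite gt_eqF.
  by field; rewrite !gt_eqF//= mulr_gt0.
rewrite /obstruction_density sa leb2_obstructed_cell_gt0// leNgt h/= -EFinM.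
by congr (_%:E); rewrite /fB; field; rewrite !gt_eqF//= mulr_gt0.
Qed.

(** From [pi] on, [sin a <= 0] and the edge is not faced; below [pi], [phi - a] lies in [0, pi], so
    [S a <= 0]. Hence the upper limit [phi - pi] of the integral. *)
Lemma obstruction_density0 (a : R) : 0 <= a < 2 * pi -> phi - pi <= a ->
  obstruction_density a = 0%E.
Proof.
move=> /andP[a0 a2] ha; rewrite /obstruction_density; case: ifPn => // sa.
rewrite leb2_obstructed_cell_le0 ?mule0//.
have api : a < pi.
  rewrite ltNge; apply/negP => pia; move: sa; apply/negP; rewrite -leNgt.
  rewrite -oppr_ge0 -sin2piB; apply: sin_ge0_pi; apply/andP; split; lra.
rewrite /S -oppr_ge0 -sinN; apply: sin_ge0_pi.
by have h := phi1; have pi0 := pi_gt0 R; apply/andP; split; lra.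
Qed.

Lemma obstruction_density_ge0 (a : R) : (0 <= obstruction_density a)%E.
Proof.
rewrite /obstruction_density; case: ifPn => // sa.
by rewrite mule_ge0// lee_fin mulr_ge0// ltW.
Qed.

Lemma obstruction_density_periodic (a : R) :
  obstruction_density (a + 2 * pi) = obstruction_density a.
Proof.
have h x : sin (x + 2 * pi) = sin x by rewrite mulr_natl sinD2pi.
rewrite /obstruction_density h /obstructed_cell.
by rewrite (_ : a + 2 * pi - phi = a - phi + 2 * pi) ?h//; ring.
Qed.

(** The cells are the sections of a single measurable set of triples (angle, edge parameter,
    distance). *)
Lemma measurable_obstruction_density : measurable_fun setT obstruction_density.
Proof.
have ms : measurable_fun setT (@sin R : R1 -> R).
  exact: continuous_measurable_fun (@continuous_sin R).
have mD : @measurable _ (R1 * R2)%type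
    [set z | [/\ 0 <= z.2.1 <= 1, 0 < z.2.2 <= r &
                 - z.2.1 * l * sin phi <= z.2.2 * sin (z.1 - phi)]].
  have -> : [set z : R1 * R2 | [/\ 0 <= z.2.1 <= 1, 0 < z.2.2 <= r &
      - z.2.1 * l * sin phi <= z.2.2 * sin (z.1 - phi)]] =
     snd @^-1` (`[0, 1]%classic `*` `]0, r]%classic) `&`
     [set z | 0 <= z.2.2 * sin (z.1 - phi) - (- z.2.1 * l * sin phi)].
    apply/seteqP; split => z /=; rewrite !in_itv/= subr_ge0; first by case.
    by move=> [[? ?] ?]; split.
  apply: measurableI.
    rewrite -[X in measurable X]setTI.
    by apply: (@measurable_snd _ _ R1 R2) => //; exact: measurableX.
  apply: measurable_ge0.
  have m1 : measurable_fun setT (fun z : R1 * R2 => z.2.1).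
    by apply: (measurableT_comp (@measurable_fst _ _ R1 R1)); exact: measurable_snd.
  have m2 : measurable_fun setT (fun z : R1 * R2 => z.2.2).
    by apply: (measurableT_comp (@measurable_snd _ _ R1 R1)); exact: measurable_snd.
  have m3 : measurable_fun setT (fun z : R1 * R2 => sin (z.1 - phi)).
    by apply: (measurableT_comp ms); apply: measurable_funB.
  apply: measurable_funB; first exact: measurable_funM.
  by do 2 apply: measurable_funM => //; exact: measurable_funN.
have mA : measurable_fun setT (fun a : R1 => leb2 (obstructed_cell a)).
  have := @measurable_fun_xsection _ _ R1 R2 R (@leb2 R) _ mD.
  apply: eq_measurable_fun => a _ /=; congr leb2.
  by apply/seteqP; split => z; rewrite /xsection/= inE.
apply: measurable_fun_ifT => //.
  exact: measurable_fun_ltr.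
apply: emeasurable_funM => //.
by apply/measurable_EFinP; exact: measurable_funM.
Qed.

(** The formula for the density is asked only in the open interval, since [sin a] vanishes at 0 and
    [S a] at [phi - pi]. *)
Let piece (f F : R -> R) (x y : R) : x <= y ->
  (forall a : R, x < a < y -> obstruction_density a = (f a)%:E) ->
  (forall a : R, x <= a <= y -> f @ a --> f a) ->
  (forall a : R, x <= a <= y -> is_derive a 1 F (f a)) ->
  (\int[mu]_(a in `[x, y[) obstruction_density a = (F y - F x)%:E)%E.
Proof.
move=> xy Jf cf dF; rewrite integral_itv_bndoo; last first.
  exact: measurable_funTS measurable_obstruction_density.
rewrite -(integral_antiderivative xy cf dF) -integral_itv_oo_cc//.
by apply: eq_integral => a; rewrite inE/= in_itv/= => /Jf.
Qed.

Let tail : (\int[mu]_(a in `[(phi - pi)%R, (2 * pi)%R[) obstruction_density a = 0)%E.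
Proof.
apply: integral0_eq => a; rewrite /= in_itv/= => /andP[h1 h2].
by apply: obstruction_density0 => //; apply/andP; split => //; have := phi1; lra.
Qed.

Let split2pi (x : R) : 0 <= x <= 2 * pi ->
  (\int[mu]_(a in `[0%R, (2 * pi)%R[) obstruction_density a =
  \int[mu]_(a in `[0%R, x[) obstruction_density a +
  \int[mu]_(a in `[x, (2 * pi)%R[) obstruction_density a)%E.
Proof.
move=> /andP[x0 x2]; apply: ge0_integral_itv_split => //.
  exact: measurable_obstruction_density.
exact: obstruction_density_ge0.
Qed.

Let sin_gt0_range (a : R) : 0 < a < phi - pi -> 0 < sin a /\ 0 < S a.
Proof.
move=> /andP[a0 ad]; split; first by apply: sin_gt0_pi; have := phi2; lra.
rewrite /S -[a - phi]opprB sinN -sin2piB; apply: sin_gt0_pi.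
by have := phi1; have := phi2; lra.
Qed.

Lemma obstruction_far : (forall a : R, 0 < a < phi - pi -> r * S a <= l * b) ->
  (\int[mu]_(a in `[0%R, (2 * pi)%R[) obstruction_density a =
    (FB (phi - pi) - FB 0)%:E)%E.
Proof.
move=> h; have pi0 := pi_gt0 R; rewrite (@split2pi (phi - pi)); last first.
  by have := phi1; have := phi2; lra.
rewrite tail adde0; apply: (@piece fB) => //; first by have := phi1; lra.
by move=> a ha; have [? ?] := sin_gt0_range ha; apply: obstruction_densityB => //; exact: h.
Qed.

Lemma obstruction_near (x y : R) : 0 <= x -> x <= y -> y <= phi - pi ->
  (forall a : R, 0 < a < phi - pi -> x < a < y -> l * b <= r * S a) ->
  (forall a : R, 0 < a < phi - pi -> a < x -> r * S a <= l * b) ->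
  (forall a : R, 0 < a < phi - pi -> y < a -> r * S a <= l * b) ->
  0 < S x -> 0 < S y ->
  (\int[mu]_(a in `[0%R, (2 * pi)%R[) obstruction_density a =
    ((FB x - FB 0) + (FA y - FA x) + (FB (phi - pi) - FB y))%:E)%E.
Proof.
move=> x0 xy yd hA hB1 hB2 Sx Sy; have pi0 := pi_gt0 R.
have J0 := obstruction_density_ge0; have mJ := measurable_obstruction_density.
rewrite (@split2pi (phi - pi)); last by have := phi1; have := phi2; lra.
rewrite tail adde0 (@ge0_integral_itv_split R 0 y)//; last exact: le_trans xy.
rewrite (@ge0_integral_itv_split R 0 x)//.
(* [FA] contains [ln (S a)], so positivity is needed up to the ends, which may fall outside the open
   range [0 < a < phi - pi]. *)
have Spos a : x <= a <= y -> 0 < S a.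
  move=> /andP[xa ay].
  have [->//|ax] := eqVneq a x; have [->//|ay'] := eqVneq a y.
  have [] // := @sin_gt0_range a.
  have xa' : x < a by rewrite lt_neqAle eq_sym ax.
  have ya' : a < y by rewrite lt_neqAle ay'.
  by apply/andP; split; lra.
rewrite 2!EFinD; congr (_ + _ + _)%E.
- apply: (@piece fB FB 0 x x0) => [a /andP[a0 ax]|a _|a _]; [|exact: cont_fB|exact: derive_FB].
  have ha : 0 < a < phi - pi by apply/andP; split; lra.
  by have [? ?] := sin_gt0_range ha; apply: obstruction_densityB => //; exact: hB1.
- apply: (@piece fA FA x y xy) => a.
  + move=> /andP[xa ay]; have ha : 0 < a < phi - pi by apply/andP; split; lra.
    have [? ?] := sin_gt0_range ha; apply: obstruction_densityA => //; apply: hA => //.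
    by rewrite xa.
  + by move=> /Spos; exact: cont_fA.
  + by move=> /Spos; exact: derive_FA.
- apply: (@piece fB FB y (phi - pi) yd) => [a /andP[ya ad]|a _|a _];
    [|exact: cont_fB|exact: derive_FB].
  have ha : 0 < a < phi - pi by apply/andP; split; lra.
  by have [? ?] := sin_gt0_range ha; apply: obstruction_densityB => //; exact: hB2.
Qed.

Let S_shift (a : R) : S a = sin (phi - pi - a).
Proof.
by rewrite /S -[RHS]opprK -sinDpi -sinN; congr sin; ring.
Qed.

Let gE : gam phi l r = l * b / r.
Proof. by rewrite /gam sin2piB. Qed.

Let tanV : (tan phi)^-1 = cos phi / sin phi.
Proof. by rewrite /tan invf_div. Qed.

Let s0 : sin phi != 0.
Proof. by rewrite lt_eqF// -oppr_gt0. Qed.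

Lemma far_g12 : FB (phi - pi) - FB 0 = g12 phi l r.
Proof.
rewrite /FB /g12 /g1 tanV mulr0 sub0r sinN.
have -> : 2 * (phi - pi) - phi = phi - 2 * pi by ring.
have -> : sin (phi - 2 * pi) = sin phi by rewrite -opprB sinN sin2piB opprK.
by rewrite /b; field.
Qed.

Section near.
Let g := gam phi l r.
Let z1 := zeta1 phi l r.
Let z2 := zeta2 phi l r.
Hypotheses (g1 : g <= 1) (z10 : 0 <= z1).

Let g0 : 0 < g.
Proof. by rewrite /g gE divr_gt0// mulr_gt0. Qed.

Let g11 : -1 <= g <= 1.
Proof. by have := g1; have := g0; lra. Qed.

Let sina : sin (asin g) = g. Proof. by rewrite asinK// in_itv. Qed.

Let cosa : cos (asin g) = Num.sqrt (1 - g ^+ 2). Proof. exact: cos_asin. Qed.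

Let a0 : 0 < asin g.
Proof.
have h : asin g != 0 by apply: contraTneq g0 => a0; rewrite -sina a0 sin0 ltxx.
have pi0 := pi_gt0 R.
have := asin_lepi2 g11; have := asin_geNpi2 g11.
move=> h1 h2; rewrite lt_neqAle eq_sym h/= leNgt; apply/negP => an0.
have : sin (asin g) < sin 0 by rewrite ltr_sin// in_itv/=; lra.
by rewrite sin0 sina; have := g0; lra.
Qed.

Let z21 : z2 <= z1.
Proof. by rewrite /z1 /z2 /zeta1 /zeta2; have := asin_lepi2 g11; rewrite -/g; lra. Qed.

(** [zeta1] and [zeta2] solve [r * S a = l * b]: the sightline to the far end of the edge crosses
    the line of the adjacent edge exactly [r] before that end. *)
Let Sz1 : S z1 = g.
Proof. by rewrite S_shift /z1 /zeta1 -/g (_ : _ - _ = asin g) ?sina//; ring. Qed.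

Let Sz2 : S z2 = g.
Proof.
rewrite S_shift /z2 /zeta2 -/g (_ : _ - _ = pi - asin g); last by ring.
by rewrite sinB sinpi cospi sina; ring.
Qed.

(** Within [0 < a < phi - pi] the regime of [fA] is the interval from [zeta2] to [zeta1]. Only
    [zeta2] can leave the range, below 0, hence the positive part. *)
Lemma obstruction_near_raw : let x := pos_part z2 in
  (\int[mu]_(a in `[0%R, (2 * pi)%R[) obstruction_density a =
    ((FB x - FB 0) + (FA z1 - FA x) + (FB (phi - pi) - FB z1))%:E)%E.
Proof.
have g01 : 0 <= g <= 1 by have := g1; have := g0; lra.
have lbE : l * b = g * r by rewrite /g gE; field; rewrite gt_eqF.
have SP (a : R) : 0 < a < phi - pi -> (l * b <= r * S a) = (z2 <= a <= z1).
  move=> ha; rewrite lbE mulrC ler_pM2l// S_shift le_sin_asin//; last first.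
    by have := phi2; lra.
  by rewrite /z1 /z2 /zeta1 /zeta2 -/g; apply/idP/idP => /andP[h1 h2]; apply/andP; split; lra.
apply: obstruction_near.
- by rewrite /pos_part le_max lexx orbT.
- by rewrite /pos_part ge_max z21.
- by rewrite /z1 /zeta1 -/g; have := a0; lra.
- move=> a ha /andP[xa az]; rewrite SP//; move: xa; rewrite /pos_part gt_max => /andP[h _].
  by rewrite !ltW.
- move=> a ha; rewrite /pos_part lt_max => /orP[az|]; last by lra.
  by rewrite ltW// ltNge SP// negb_and -ltNge az.
- by move=> a ha az; rewrite ltW// ltNge SP// negb_and -!ltNge az orbT.
- rewrite /pos_part; case: (leP z2 0) => _; last by rewrite Sz2.
  by rewrite /S sub0r sinN.
- by rewrite Sz1.
Qed.

Let sin2a : sin (2 * asin g) = 2 * g * Num.sqrt (1 - g ^+ 2).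
Proof. by rewrite mulr_natl sin_mulr2n sina cosa; ring. Qed.

Let cos2a : cos (2 * asin g) = 1 - 2 * g ^+ 2.
Proof. by rewrite mulr_natl cos_mulr2n cos2sin2 sina; ring. Qed.

Let tailB : FB (phi - pi) - FB z1 = - (r ^+ 2 / 8) * g31 phi l r.
Proof.
rewrite /FB /g31 -/g tanV.
have -> : sin (2 * (phi - pi) - phi) = sin phi.
  by rewrite -[RHS]opprK -sin2piB -sinN; congr sin; ring.
have -> : sin (2 * z1 - phi) = sin (phi - 2 * asin g).
  rewrite -[RHS]opprK -sin2piB -sinN; congr sin; rewrite /z1 /zeta1 -/g; ring.
by rewrite sinB cos2a sin2a /z1 /zeta1 -/g /b; field.
Qed.

(** The regime of [fA] starts at 0, where [S] is [|sin phi|], and ends where [S] is [gam]: this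
    produces the two logarithms of [g33]. *)
Lemma near_le0 :
  (FB 0 - FB 0) + (FA z1 - FA 0) + (FB (phi - pi) - FB z1) =
  l * r * (1 - cos z1) - r ^+ 2 / 8 * g31 phi l r + g33 phi l r.
Proof.
rewrite tailB /FA Sz1 /g33 cos0 -/g -/z1.
have -> : S 0 = `|sin phi|.
  by rewrite /S sub0r sinN ltr0_norm// -oppr_gt0.
by rewrite /b; field.
Qed.

(** [S] takes the same value at both ends of the regime of [fA], so the logarithms cancel; [g34]
    keeps only the length [zeta1 - zeta2 = pi - 2 * asin gam]. *)
Lemma near_gt0 :
  (FB z2 - FB 0) + (FA z1 - FA z2) + (FB (phi - pi) - FB z1) =
  l * r * (cos z2 - cos z1) - r ^+ 2 / 8 * g31 phi l r
  + (- r ^+ 2 / 8 * g32 phi l r + g34 phi l r).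
Proof.
rewrite tailB /FA Sz1 Sz2.
have -> : FB z2 - FB 0 = - r ^+ 2 / 8 * g32 phi l r.
  rewrite /FB /g32 -/g tanV mulr0 sub0r sinN.
  have -> : sin (2 * z2 - phi) = sin (phi + 2 * asin g).
    have h (x : R) : sin (x - 2 * pi) = sin x by rewrite -opprB sinN sin2piB opprK.
    rewrite -[RHS]h -[RHS]h; congr sin; rewrite /z2 /zeta2 -/g; ring.
  rewrite sinD cos2a sin2a [2 * phi]mulr_natl sin_mulr2n cos_mulr2n cos2sin2 /z2 /zeta2 -/g /b.
  have cE : cos phi * cos phi = 1 - sin phi ^+ 2 by rewrite -expr2 cos2sin2.
  apply/eqP; rewrite -subr_eq0; apply/eqP.
  set c := cos phi in cE *; set s := sin phi in cE *; set q := Num.sqrt _.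
  (* The two sides differ by a multiple of the Pythagorean relation, isolated here so that the rest
     is a rational identity. *)
  transitivity (- (r ^+ 2 / 4) * (c * c - (1 - s ^+ 2))); last by rewrite cE; ring.
  by field.
by rewrite /g34 -/g /z1 /z2 /zeta1 /zeta2 -/g /b; field.
Qed.

End near.

(** On [0 < a < phi - pi], [S a] is [sin (phi - pi - a)]. If [phi > 3 pi / 2] the sine reaches its
    peak 1 there and [fA] can occur only from [r = l * b] on; otherwise [S] decreases from [b], the
    threshold is [r = l], and [zeta2] is never positive. These are the four conditions. *)
Theorem obstruction_total :
  (\int[mu]_(a in `[0%R, (2 * pi)%R[) obstruction_density a = (corr phi l r)%:E)%E.
Proof.
have pi0 := pi_gt0 R; have h1 := phi1; have h2 := phi2.
have absE : `|sin phi| = b by rewrite /b ltr0_norm// -oppr_gt0.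
have bE : sin (phi - pi) = b by rewrite sinB sinpi cospi /b; ring.
have b1 : b <= 1 by rewrite -bE sin_le1.
rewrite /corr /C12 /C1 /C2 /C3 /C4 absE h1 h2/= !andbT.
have [p32|p32] := ltP (3 * pi / 2) phi.
  rewrite /= ?orbF /indic; have [rl|rl] := ltP r (l * b).
    rewrite /= !mul0r !addr0 mul1r -far_g12; apply: obstruction_far => a ha.
    by apply: le_trans (ltW rl); apply: ler_piMr; [exact: ltW|exact: sin_le1].
  have g1 : gam phi l r <= 1 by rewrite gE ler_pdivrMr// mul1r.
  have g0 : 0 < gam phi l r by rewrite gE divr_gt0// mulr_gt0.
  have z10 : 0 <= zeta1 phi l r.
    have /asin_lepi2 : -1 <= gam phi l r <= 1 by lra.
    by rewrite /zeta1; lra.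
  rewrite /= !mul0r add0r addr0 mul1r obstruction_near_raw// /g3 /pos_part.
  case: (leP (zeta2 phi l r) 0) => z20.
    by rewrite near_le0// /indic/= cos0; congr (_%:E); ring.
  by rewrite near_gt0// /indic/=; congr (_%:E); ring.
rewrite /= /indic; have [rl|rl] := ltP r l.
  rewrite /= !mul0r !addr0 mul1r -far_g12; apply: obstruction_far => a /andP[a0 ad].
  rewrite S_shift -bE; apply: (@le_trans _ _ (r * sin (phi - pi))).
    rewrite ler_pM2l// leNgt ltr_sin ?in_itv/= -?leNgt; lra.
  by rewrite ler_pM2r ?bE// ltW.
have gb : gam phi l r <= b by rewrite gE ler_pdivrMr// mulrC ler_pM2l.
have g0 : 0 < gam phi l r by rewrite gE divr_gt0// mulr_gt0.
have g1 := le_trans gb b1.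
have z10 : 0 <= zeta1 phi l r.
  have : gam phi l r <= sin (phi - pi) by rewrite bE.
  by rewrite le_sin_asin; [move=> /andP[]|..]; rewrite /zeta1; lra.
have z20 : zeta2 phi l r <= 0.
  have /asin_lepi2 : -1 <= gam phi l r <= 1 by lra.
  by rewrite /zeta2; lra.
rewrite /= !mul0r add0r mul1r obstruction_near_raw// /g4 /pos_part max_r//.
by rewrite near_le0// add0r.
Qed.

End obstruction.

(** * Unobstructed and obstructed measure of one edge *)

Section edge_measures.
Variable R : realType.
Local Notation mu := (@lebesgue_measure R).
Local Notation R1 := (measurableTypeR R).
Local Notation R2 := (R1 * R1)%type.
Local Notation R3 := (R2 * R1)%type.
Variables (P : pt R) (w l sg r : R).
Hypotheses (sg2 : sg ^+ 2 = 1) (l0 : 0 < l) (r0 : 0 < r).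

Let sin_aff th : sin (affine (sg * w) (- sg) th) = sg * sin (w - th).
Proof. by rewrite -(sin_sgM sg2); congr sin; rewrite /affine; ring. Qed.

Let f (a : R) : \bar R := if 0 < sin a then (l * r * sin a)%:E else 0%E.

Let mf : measurable_fun setT f.
Proof.
have ms : measurable_fun setT (@sin R : R1 -> R).
  exact: continuous_measurable_fun (@continuous_sin R).
apply: measurable_fun_ifT => //; first exact: measurable_fun_ltr.
by apply/measurable_EFinP; exact: measurable_funM.
Qed.

Let f0 a : (0 <= f a)%E.
Proof. by rewrite /f; case: ifPn => // sa; rewrite lee_fin !mulr_ge0// ltW. Qed.

Lemma integral_sin_pos :
  (\int[mu]_(a in `[0%R, (2 * pi)%R[) f a = (2 * l * r)%:E)%E.
Proof.
have pi0 := pi_gt0 R.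
rewrite (@ge0_integral_itv_split R 0 pi)//; [|exact: ltW|lra].
rewrite [X in (_ + X)%E]integral0_eq; last first.
  move=> a; rewrite /= in_itv/= => /andP[a1 a2]; rewrite /f ltNge.
  rewrite (_ : sin a <= 0)// -oppr_ge0 -sin2piB; apply: sin_ge0_pi; lra.
rewrite adde0 integral_itv_bndoo; last exact: measurable_funTS.
transitivity (\int[mu]_(a in `]0%R, (@pi R)[) (l * r * sin a)%:E)%E.
  apply: eq_integral => a; rewrite inE/= in_itv/= => ha.
  by rewrite /f sin_gt0_pi.
have cf (x : R) : (fun a : R => l * r * sin a) a @[a --> x] --> l * r * sin x.
  by apply: cvgM; [exact: cvg_cst|exact: continuous_sin].
rewrite integral_itv_oo_cc//.
transitivity ((- (l * r) * cos pi) - (- (l * r) * cos 0))%:E.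
  apply: (@integral_antiderivative R (fun a => l * r * sin a) (fun a => - (l * r) * cos a)) => //.
    exact: ltW.
  by move=> x _; apply: is_derive_eq; rewrite /GRing.scale/=; ring.
by rewrite cospi cos0; congr (_%:E); ring.
Qed.

Lemma leb3_facing_total : leb3 (facing P w l sg r) = (2 * l * r)%:E.
Proof.
have pi0 := pi_gt0 R.
have -> : facing P w l sg r = facing P w l sg r `&` [set c | [set: pt R] c.1].
  by apply/seteqP; split => c // [].
rewrite leb3_facing//.
rewrite -integral_sin_pos -[RHS](@integral_periodic R (2 * pi) f _ _ _ _ (sg * w) (- sg)).
- apply: eq_integral => th _; rewrite /f sin_aff; case: ifPn => // s0.
  rewrite (_ : chart_cell _ _ _ _ _ _ = `[0, 1]%classic `*` `]0, r]%classic); last first.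
    apply/seteqP; split => z /=; rewrite !in_itv/=; first by case.
    by move=> [? ?]; split.
  have mE : leb2 (`[0, 1]%classic `*` `]0, r]%classic : set R2) = r%:E.
    have i1 : mu `[0, 1]%classic = 1%:E.
      by rewrite lebesgue_measure_itv/= lte_fin ltr01 oppr0 adde0.
    have i2 : mu `]0, r]%classic = r%:E.
      by rewrite lebesgue_measure_itv/= lte_fin r0 oppr0 adde0.
    have := @product_measure1E _ _ R1 R1 R mu mu `[0, 1]%classic `]0, r]%classic
      (measurable_itv _) (measurable_itv _).
    by rewrite /leb2 => ->; rewrite [X in (X * _)%E]i1 [X in (_ * X)%E]i2 mul1e.
  by rewrite mE -EFinM; congr (_%:E); ring.
- lra.
- exact: mf.
- exact: f0.
- by move=> a; rewrite /f mulr_natl sinD2pi.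
- by rewrite normrN (sg_norm sg2).
Qed.

Section obstructed.
Variable phi : R.
Hypothesis phi12 : pi < phi < 2 * pi.

Lemma beyond_ray_chart th u t :
  beyond P w sg phi (ray_chart P w l th (u, t)) =
  - u * l * sin phi - t * sin (affine (sg * w) (- sg) th - phi).
Proof.
have -> : sin (affine (sg * w) (- sg) th - phi) = sg * sin (w - sg * phi - th).
  rewrite -(sin_sgM sg2); congr sin; rewrite /affine.
  transitivity (sg * (w - th) - sg ^+ 2 * phi); first by rewrite sg2; ring.
  by ring.
have -> : - u * l * sin phi = u * l * (sg * sin (w - sg * phi - w)).
  rewrite (_ : w - sg * phi - w = - (sg * phi)); last by ring.
  by rewrite sinN (sin_sgM sg2) -[LHS]mul1r -sg2; ring.
by rewrite -!cross_dir /beyond /cross /vsub /ray_chart /affine2 /dir/=; ring.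
Qed.

Lemma measurable_beyond : measurable_fun setT (beyond P w sg phi : R2 -> R).
Proof. by rewrite /beyond /cross /vsub/=; measurable_poly. Qed.

Lemma leb3_obstructed :
  leb3 (facing P w l sg r `&` [set c | [set q | beyond P w sg phi q <= 0] c.1]) =
  (corr phi l r)%:E.
Proof.
have pi0 := pi_gt0 R.
have /andP[phi1 phi2] := phi12.
rewrite leb3_facing//; last first.
  have -> : [set q | beyond P w sg phi q <= 0] = [set q : R2 | 0 <= - beyond P w sg phi q].
    by apply/seteqP; split => q /=; rewrite oppr_ge0.
  by apply: measurable_ge0; apply: measurable_funN; exact: measurable_beyond.
have per := @integral_periodic R (2 * pi) (obstruction_density phi l r) _
  (@measurable_obstruction_density R phi l r) (@obstruction_density_ge0 R phi l r l0)
  (@obstruction_density_periodic R phi l r) (sg * w) (- sg).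
rewrite -(obstruction_total phi1 phi2 l0 r0) -per; last 2 first.
- by lra.
- by rewrite normrN (sg_norm sg2).
apply: eq_integral => th _; rewrite /obstruction_density sin_aff.
case: (0 < sg * sin (w - th)); last by [].
rewrite (_ : chart_cell _ _ _ _ _ _ = obstructed_cell phi l r (affine (sg * w) (- sg) th));
  first by [].
have bE z : beyond P w sg phi (ray_chart P w l th z) <= 0 =
    (- z.1 * l * sin phi <= z.2 * sin (affine (sg * w) (- sg) th - phi)).
  by case: z => u t; rewrite beyond_ray_chart subr_le0.
apply/seteqP; split => z [h1 h2 h3].
  by split; [exact: h1|exact: h2|rewrite -bE; exact: h3].
by split; [exact: h1|exact: h2|rewrite -bE in h3; exact: h3].
Qed.

End obstructed.

Variable phi : R.

Definition shadowed : set (cfg R) := [set c | facing P w l sg r c /\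
  exists t u : R, [/\ 0 <= t <= r, 0 <= u <= 1, raypt c.1 c.2 t = edge_pt P w l u &
    exists t' : R, 0 <= t' < t /\ sector P w sg phi (raypt c.1 c.2 t')]].

Lemma rayptE (c : cfg R) t u : raypt c.1 c.2 t = edge_pt P w l u ->
  c.1 = ray_chart P w l c.2 (u, t).
Proof.
case: c => -[x y] th; rewrite /raypt /edge_pt /ray_chart /affine2/=.
by move=> [h1 h2]; congr pair; lra.
Qed.

Lemma shadowed_convex : phi <= pi -> shadowed = set0.
Proof.
move=> phipi; apply/seteqP; split => // c [fc [t [u [tr u01 e [t' [t't sec]]]]]].
have s0 := facing_angle fc.
move: sec; rewrite (rayptE e) raypt_ray_chart => /(sector_convex sg2 phipi).
by rewrite height_ray_chart pmulr_lle0// subr_le0 leNgt; case/andP: t't => _ ->.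
Qed.

(** Along a sightline [beyond] is affine and nonnegative at the edge point. If it is nonpositive
    somewhere before, it is so at the sensor too. *)
Lemma shadowed_reflex : pi < phi < 2 * pi ->
  shadowed = facing P w l sg r `&` [set c | [set q | beyond P w sg phi q <= 0] c.1].
Proof.
move=> phi12; have sphi : sin phi < 0 by exact: sin_lt0_pi.
apply/seteqP; split => c.
  move=> [fc [t [u [tr u01 e [t' [/andP[t'0 t't] sec]]]]]]; split => //=.
  have s0 := facing_angle fc.
  move: sec; rewrite (rayptE e) raypt_ray_chart.
  move=> /(sector_reflex sg2 phi12); rewrite height_ray_chart mulr_gt0 ?subr_gt0//.
  move=> /(_ isT); rewrite !beyond_ray_chart.
  set S := sin (affine _ _ _ - phi); rewrite !subr_le0 => h; rewrite leNgt; apply/negP => h'.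
  have u0 : 0 <= u by case/andP: u01.
  have ul : 0 <= u * l * - sin phi by rewrite !mulr_ge0 ?oppr_ge0// ltW.
  have [S0|S0] := leP 0 S.
    have : 0 <= t' * S by rewrite mulr_ge0.
    by lra.
  have : (t - t') * S < 0 by rewrite nmulr_llt0// subr_gt0.
  by lra.
move=> [fc /= b0]; have [_ h [t [u [tr u01 e]]]] := fc; split => //.
(* The sensor itself already stands in the sector; [t] is positive since the sensor is off the edge
   line. *)
exists t, u; split => //; exists 0; split.
  rewrite lexx/= lt_neqAle eq_sym; case/andP: tr => -> _; rewrite andbT.
  apply: contraTneq h => t0; rewrite (rayptE e) height_ray_chart t0 mul0r.
  by rewrite ltxx.
rewrite (_ : raypt c.1 c.2 0 = c.1); first by apply/sector_reflex.
by case: (c.1) => x y; rewrite /raypt/=; congr pair; ring.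
Qed.

Lemma leb3_shadowed : phi < 2 * pi -> leb3 shadowed = (corr phi l r)%:E.
Proof.
have pi0 := pi_gt0 R.
move=> phi2; have [phipi|phipi] := leP phi pi; last first.
  by rewrite shadowed_reflex ?phipi// leb3_obstructed// phipi.
rewrite shadowed_convex//; have -> : corr phi l r = 0.
  have p32 : 3 * pi / 2 < phi = false by apply/negP => h; lra.
  rewrite /corr /C12 /C1 /C2 /C3 /C4 p32/= ltNge phipi/= /indic; ring.
exact: (measure0 (@leb2 R \x mu)%E).
Qed.

End edge_measures.

(** * Vertices and edges of a polygon *)

Section vectors.
Variable R : realType.

Definition polar (rho x : R) : pt R := (rho * cos x, rho * sin x).

Lemma dotp_polar (a b x y : R) : dotp (polar a x) (polar b y) = a * b * cos (y - x).
Proof. by rewrite /dotp /= cosB; ring. Qed.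

Lemma cross_polar (a b x y : R) : cross (polar a x) (polar b y) = a * b * sin (y - x).
Proof. by rewrite /cross /= sinB; ring. Qed.

Lemma enorm_polar (a x : R) : 0 <= a -> enorm (polar a x) = a.
Proof.
by move=> a0; rewrite /enorm dotp_polar subrr cos0 mulr1 -expr2 sqrtr_sqr ger0_norm.
Qed.

Lemma polar_vsub (p q : pt R) : p <> q ->
  0 < eucl_dist p q /\ exists x, vsub p q = polar (eucl_dist p q) x.
Proof.
move=> pq; have [rho [x [rho0 _ h1 h2]]] := polar_exists (vsub p q).1 (vsub p q).2.
have pE : vsub p q = polar rho x by rewrite [LHS]surjective_pairing h1 h2.
rewrite /eucl_dist pE enorm_polar//; split; last by exists x.
rewrite lt_neqAle rho0 andbT eq_sym; apply/eqP => r00; apply: pq.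
move: pE; rewrite r00 /polar !mul0r; case: p {h1 h2} => p1 p2; case: q => q1 q2.
by rewrite /vsub/= => -[/eqP + /eqP]; rewrite !subr_eq0 => /eqP -> /eqP ->.
Qed.

Lemma eucl_distC (p q : pt R) : eucl_dist p q = eucl_dist q p.
Proof. by rewrite /eucl_dist /enorm /dotp /vsub/=; congr Num.sqrt; ring. Qed.

Lemma ccw_angle_polar (a b x y : R) : 0 < a -> 0 < b ->
  let phi := ccw_angle (polar a x) (polar b y) in
  [/\ 0 <= phi < 2 * pi, cos phi = cos (y - x) & sin phi = sin (y - x)].
Proof.
move=> a0 b0; rewrite /ccw_angle dotp_polar cross_polar.
rewrite (enorm_polar _ (ltW a0)) (enorm_polar _ (ltW b0)).
have ab0 : 0 < a * b by rewrite mulr_gt0.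
have := @arg_spec R (a * b * cos (y - x)) (a * b * sin (y - x)) (a * b) ab0.
rewrite !exprMn -mulrDr cos2Dsin2 mulr1 => /(_ erefl) /= [h1 h2 h3].
have inj := @mulfI R _ (negbT (gt_eqF ab0)).
by split; [exact: h1|exact/esym/inj|exact/esym/inj].
Qed.

End vectors.

Section polygon.
Variables (R : realType) (n : nat) (v : nat -> pt R).
Hypothesis simp : simple_polygon n v.
Local Notation vtx := (vtx n v).
Local Notation sh := (0 < shoelace n v).

Lemma polygon_size : (3 <= n)%N. Proof. by case: simp. Qed.

Lemma vtx_modn i : vtx (i %% n) = vtx i.
Proof. by rewrite /Defs.vtx modn_mod. Qed.

Lemma vtx_modnS i : vtx (i %% n).+1 = vtx i.+1.
Proof. by rewrite /Defs.vtx -addn1 modnDml addn1. Qed.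

Lemma vtx_addn i : vtx (i + n) = vtx i.
Proof. by rewrite /Defs.vtx modnDr. Qed.

Lemma vtx_neq i : vtx i <> vtx i.+1.
Proof.
case: simp => n3 [h _]; have := h (i %% n)%N; rewrite vtx_modn vtx_modnS; apply.
by rewrite ltn_mod; apply: leq_trans n3.
Qed.

Lemma edge_modn i : edge n v (i %% n) = edge n v i.
Proof. by rewrite /edge vtx_modn vtx_modnS. Qed.

Section vertex.
Variables (k : nat) (xu xw : R).
Let P := vtx k.+1.
Let lu := edge_len n v k.
Let lw := edge_len n v k.+1.
Let phi := inner_angle n v k.
Hypotheses (uE : vsub (vtx k) P = polar lu xu) (wE : vsub (vtx k.+2) P = polar lw xw).

Let lu0 : 0 < lu.
Proof. by have [] := @polar_vsub R (vtx k.+1) (vtx k) (fun e => vtx_neq (esym e)). Qed.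

Let lw0 : 0 < lw.
Proof. by have [] := @polar_vsub R (vtx k.+2) (vtx k.+1) (fun e => vtx_neq (esym e)). Qed.

(** Two consecutive edges leaving their vertex in the same direction would overlap. This excludes a
    zero angle, which a clockwise polygon would turn into 2 pi. *)
Lemma edge_nondegenerate : cos (xu - xw) != 1.
Proof.
apply/eqP => c1; have s0 : sin (xu - xw) = 0 by apply: cos1sin0; rewrite c1 normr1.
have cE : cos xu = cos xw by rewrite -[xu](subrK xw) cosD c1 s0; ring.
have sE : sin xu = sin xw by rewrite -[xu](subrK xw) sinD c1 s0; ring.
have [n3 [_ h]] := simp.
(* The point at distance [m] from the vertex lies on both edges without being the vertex. *)
pose m := Num.min lu lw; have m0 : 0 < m by rewrite lt_min lu0 lw0.
pose p : pt R := (P.1 + m * cos xu, P.2 + m * sin xu).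
have n0 : (0 < n)%N by exact: leq_trans n3.
have e1 : edge n v (k %% n) p.
  rewrite edge_modn /edge /seg; exists (1 - m / lu); split.
    have : 0 < m / lu by rewrite divr_gt0.
    have : m / lu <= 1 by rewrite ler_pdivrMr// mul1r ge_min lexx.
    lra.
  move: uE; rewrite /vsub /polar /p -/P => -[h1 h2].
  have -> : (vtx k).1 = P.1 + lu * cos xu by lra.
  have -> : (vtx k).2 = P.2 + lu * sin xu by lra.
  by congr pair; field; rewrite gt_eqF.
have e2 : edge n v (k.+1 %% n) p.
  rewrite edge_modn /edge /seg; exists (m / lw); split.
    have : 0 < m / lw by rewrite divr_gt0.
    have : m / lw <= 1 by rewrite ler_pdivrMr// mul1r ge_min lexx orbT.
    lra.
  move: wE; rewrite /vsub /polar /p -/P => -[h1 h2].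
  rewrite h1 h2 cE sE.
  by congr pair; field; rewrite gt_eqF.
have := h (k %% n)%N (k.+1 %% n)%N p; rewrite !ltn_mod !n0 => /(_ isT isT).
have kk : (k %% n)%N <> (k.+1 %% n)%N.
  move=> /eqP; rewrite -[X in X == _ %[mod _]]addn0 -addn1 eqn_modDl.
  by rewrite !modn_small//; apply: leq_trans n3.
move=> /(_ kk e1 e2) [[_]|[kE _]].
  rewrite vtx_modnS -/P /p; case: (P) => P1 P2 /= [h1 h2].
  have c0 : cos xu = 0 by nra.
  have s0' : sin xu = 0 by nra.
  by have := cos2Dsin2 xu; rewrite c0 s0' expr0n/= addr0 => /esym/eqP; rewrite oner_eq0.
(* The remaining alternative would make [k] and [k + 2] congruent modulo [n], against [3 <= n]. *)
move: kE; rewrite -addn1 modnDml addn1 => /eqP.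
rewrite -[X in X == _ %[mod _]]addn0 -addn2 eqn_modDl.
by rewrite !modn_small//; apply: leq_trans n3.
Qed.

(** Counterclockwise, the sector runs from [xs] to [xe], whatever the orientation of the polygon. *)
Let xs := if sh then xw else xu.
Let xe := if sh then xu else xw.

Lemma inner_angle_spec : [/\ 0 <= phi < 2 * pi, cos phi = cos (xe - xs) &
  sin phi = sin (xe - xs)].
Proof.
rewrite /phi /inner_angle -/P uE wE.
have [/andP[h1 h2] hc hs] := ccw_angle_polar xw xu lw0 lu0.
set a := ccw_angle _ _ in h1 h2 hc hs *.
rewrite /xe /xs; case: ifPn => _; first by split => //; rewrite h1.
have a0 : a != 0.
  by apply: contra edge_nondegenerate => /eqP a0; rewrite -hc a0 cos0.
have a0' : 0 < a by rewrite lt_neqAle eq_sym a0.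
rewrite cos2piB sin2piB hc hs -[xw - xu]opprB cosN sinN; split => //.
by apply/andP; split; lra.
Qed.

Let sector_start : vertex_sector n v k = sector P xs (-1) phi.
Proof.
have sE : (if sh then vsub (vtx k.+2) (vtx k.+1) else vsub (vtx k) (vtx k.+1))
    = polar (if sh then lw else lu) xs.
  by rewrite /xs -/P uE wE; case: ifP.
have ls0 : 0 < (if sh then lw else lu) by case: ifP.
rewrite /vertex_sector sE -/P -/phi; move: (if sh then lw else lu) ls0 => ls ls0.
apply/seteqP; split => q [rho [psi]].
  move=> [rho0 [psi0 ->]]; exists (rho * ls), psi; split => //.
    by rewrite mulr_ge0// ltW.
  by rewrite /dir /polar/= mulN1r opprK cosD sinD; congr pair; ring.
move=> [rho0 psi0 ->]; exists (rho / ls), psi; split; first by rewrite divr_ge0// ltW.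
split => //; rewrite /dir /polar/= mulN1r opprK cosD sinD.
by congr pair; field; rewrite gt_eqF.
Qed.

(** Replacing [psi] by [phi - psi] reads the sector clockwise from its last side, so either edge at
    the vertex can serve as the base of the local model. *)
Let sector_end : vertex_sector n v k = sector P xe 1 phi.
Proof.
rewrite sector_start; have [phi0 hc hs] := inner_angle_spec.
have dE (psi : R) : dir (xe - psi) = dir (xs + (phi - psi)).
  have c : cos (phi - psi) = cos (xe - xs - psi) by rewrite 2!(cosB _ psi) hc hs.
  have s : sin (phi - psi) = sin (xe - xs - psi) by rewrite 2!(sinB _ psi) hc hs.
  rewrite /dir (cosD xs) (sinD xs) c s -cosD -sinD.
  by congr pair; congr (_ _); ring.
apply/seteqP; split => q [rho [psi [rho0 /andP[psi0 psi1] ->]]];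
    exists rho, (phi - psi); split => //; try by apply/andP; split; lra.
  by rewrite mul1r mulN1r opprK dE (_ : phi - (phi - psi) = psi)//; ring.
by rewrite mul1r mulN1r opprK dE.
Qed.

Lemma vertex_sector_u : vertex_sector n v k = sector P xu (if sh then 1 else -1) phi.
Proof. by move: sector_start sector_end; rewrite /xs /xe; case: ifP. Qed.

Lemma vertex_sector_w : vertex_sector n v k = sector P xw (if sh then -1 else 1) phi.
Proof. by move: sector_start sector_end; rewrite /xs /xe; case: ifP. Qed.

End vertex.
End polygon.

(** * Naive and blocked sets of polygon edges *)

Section detection.
Variables (R : realType) (n : nat) (v : nat -> pt R) (r : R).
Hypotheses (simp : simple_polygon n v) (r0 : 0 < r).
Local Notation vtx := (vtx n v).
Local Notation sh := (0 < shoelace n v).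

Section edge.
Variables (i : nat) (P : pt R) (x l sg : R).
Hypothesis eE : forall p, edge n v i p <-> exists u, 0 <= u <= 1 /\ p = edge_pt P x l u.
Hypothesis oE : forall p, outer_side n v i p <-> 0 < height P x sg p.

Lemma naive_set_facing : naive_set n v i r = facing P x l sg r.
Proof.
apply/seteqP; split => c.
  move=> [c2 [/oE h [t [tr /eE[u [u01 e]]]]]]; split => //.
  by exists t, u; split.
move=> [c2 h [t [u [tr u01 e]]]]; split => //; split; first exact/oE.
by exists t; split => //; apply/eE; exists u.
Qed.

Lemma blocked_set_shadowed k phi : vertex_sector n v k = sector P x sg phi ->
  blocked_set n v i k r = shadowed P x l sg r phi.
Proof.
move=> sE; rewrite /blocked_set naive_set_facing sE; apply/seteqP; split => c.
  move=> [fc [t [tr [/eE[u [u01 e]] [t' [t't sec]]]]]]; split => //.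
  by exists t, u; split => //; exists t'.
move=> [fc [t [u [tr u01 e [t' [t't sec]]]]]]; split => //.
exists t; split => //; split; first by apply/eE; exists u.
by exists t'.
Qed.

End edge.

Let sgu : R := if sh then 1 else -1.
Let sgw : R := if sh then -1 else 1.

Let sgu2 : sgu ^+ 2 = 1. Proof. by rewrite /sgu; case: ifP => _; ring. Qed.
Let sgw2 : sgw ^+ 2 = 1. Proof. by rewrite /sgw; case: ifP => _; ring. Qed.

Let edge_len_gt0 i : 0 < edge_len n v i.
Proof. by have [] := @polar_vsub R (vtx i.+1) (vtx i) (fun e => vtx_neq simp (esym e)). Qed.

Let polar_out i : exists x, vsub (vtx i.+1) (vtx i) = polar (edge_len n v i) x.
Proof. by have [] := @polar_vsub R (vtx i.+1) (vtx i) (fun e => vtx_neq simp (esym e)). Qed.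

Let polar_in i : exists x, vsub (vtx i) (vtx i.+1) = polar (edge_len n v i) x.
Proof.
have [_] := @polar_vsub R (vtx i) (vtx i.+1) (@vtx_neq _ _ _ simp i).
by rewrite eucl_distC.
Qed.

(** Each edge is parametrised from both of its ends, because the local model measures from the
    obstructing vertex. *)
Lemma edge_out i x : vsub (vtx i.+1) (vtx i) = polar (edge_len n v i) x ->
  forall p, edge n v i p <-> exists u, 0 <= u <= 1 /\ p = edge_pt (vtx i) x (edge_len n v i) u.
Proof.
rewrite /vsub /polar /edge_pt => -[<- <-] p; split.
  by move=> [t [t01 ->]]; exists t; split.
by move=> [t [t01 ->]]; exists t; split.
Qed.

Lemma edge_in i x : vsub (vtx i) (vtx i.+1) = polar (edge_len n v i) x ->
  forall p, edge n v i p <->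
    exists u, 0 <= u <= 1 /\ p = edge_pt (vtx i.+1) x (edge_len n v i) u.
Proof.
rewrite /vsub /polar /edge_pt => -[<- <-] p; split.
  move=> [t [/andP[t0 t1] ->]]; exists (1 - t); split; first by apply/andP; split; lra.
  by congr pair; ring.
move=> [t [/andP[t0 t1] ->]]; exists (1 - t); split; first by apply/andP; split; lra.
by congr pair; ring.
Qed.

Lemma outer_out i x : vsub (vtx i.+1) (vtx i) = polar (edge_len n v i) x ->
  forall p, outer_side n v i p <-> 0 < height (vtx i) x sgw p.
Proof.
move=> e p; have l0 := edge_len_gt0 i.
rewrite /outer_side e /sgw; set q := vsub p _.
have cE : cross (polar (edge_len n v i) x) q = edge_len n v i * cross (dir x) q.
  by rewrite /cross /polar /dir/=; ring.
rewrite cE /height -/q; case: ifP => _.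
  by rewrite pmulr_rlt0// mulN1r oppr_gt0.
by rewrite pmulr_rgt0// mul1r.
Qed.

Lemma outer_in i x : vsub (vtx i) (vtx i.+1) = polar (edge_len n v i) x ->
  forall p, outer_side n v i p <-> 0 < height (vtx i.+1) x sgu p.
Proof.
move=> e p; have l0 := edge_len_gt0 i.
rewrite /outer_side /sgu; set q := vsub p _.
have cE : cross (vsub (vtx i.+1) (vtx i)) q =
    - (edge_len n v i * cross (dir x) (vsub p (vtx i.+1))).
  transitivity (- cross (polar (edge_len n v i) x) (vsub p (vtx i.+1))).
    by rewrite -e /q /cross /vsub/=; ring.
  by rewrite /cross /polar /dir/=; ring.
rewrite cE /height; case: ifP => _.
  by rewrite oppr_lt0 pmulr_rgt0// mul1r.
by rewrite oppr_gt0 pmulr_rlt0// mulN1r oppr_gt0.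
Qed.

Lemma leb3_naive_set i : leb3 (naive_set n v i r) = (2 * edge_len n v i * r)%:E.
Proof.
have [x xE] := polar_out i.
rewrite (naive_set_facing (edge_out xE) (outer_out xE)).
exact: leb3_facing_total.
Qed.

Lemma inner_angle_lt i : inner_angle n v i < 2 * pi.
Proof.
have [x xE] := polar_in i; have [y yE] := polar_out i.+1.
by have [/andP[]] := inner_angle_spec simp xE yE.
Qed.

Lemma leb3_blocked_far i : leb3 (blocked_set n v i i r) =
  (corr (inner_angle n v i) (edge_len n v i) r)%:E.
Proof.
have [x xE] := polar_in i; have [y yE] := polar_out i.+1.
rewrite (blocked_set_shadowed (edge_in xE) (outer_in xE) (vertex_sector_u simp xE yE)).
exact: (leb3_shadowed _ _ sgu2 (edge_len_gt0 i) r0 (inner_angle_lt i)).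
Qed.

Lemma leb3_blocked_near i : leb3 (blocked_set n v i (i + n.-1) r) =
  (corr (inner_angle n v (i + n.-1)) (edge_len n v i) r)%:E.
Proof.
have [x xE] := polar_in (i + n.-1); have [y yE] := polar_out (i + n.-1).+1.
have n0 : (0 < n)%N by apply: leq_trans (polygon_size simp).
(* [i + n.-1] stands for [i - 1] modulo [n], so its vertex is the starting point of edge [i]. *)
have v1 : vtx (i + n.-1).+1 = vtx i by rewrite -addnS prednK// vtx_addn.
have v2 : vtx (i + n.-1).+2 = vtx i.+1 by rewrite -addSn -addnS prednK// vtx_addn.
have lE : edge_len n v (i + n.-1).+1 = edge_len n v i by rewrite /edge_len v1 v2.
have sE := vertex_sector_w simp xE yE.
move: yE; rewrite lE v2 v1 => yE; rewrite v1 in sE.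
rewrite (blocked_set_shadowed (edge_out yE) (outer_out yE) sE).
exact: (leb3_shadowed _ _ sgw2 (edge_len_gt0 i) r0 (inner_angle_lt _)).
Qed.

End detection.

(** * Decomposition of the hit event *)

Section null_lines.
Variable R : realType.
Local Notation mu := (@lebesgue_measure R).
Local Notation R1 := (measurableTypeR R).
Local Notation R2 := (R1 * R1)%type.
Local Notation R3 := (R2 * R1)%type.

HB.instance Definition _ := Measure.on (@leb3 R).

(* Configurations whose line of sight passes through [V]; they contain all
   double detections, since distinct edges only meet at vertices. *)
Definition aimed (V : pt R) : set R3 := [set c | cross (vsub c.1 V) (dir c.2) = 0].

Lemma measurable_aimed V : measurable (aimed V).
Proof.
pose f (c : R3) := cross (vsub c.1 V) (dir c.2).
have mf : measurable_fun setT f.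
  have m11 : measurable_fun setT (fun c : R3 => c.1.1).
    by apply: (measurableT_comp (@measurable_fst _ _ R1 R1)); exact: measurable_fst.
  have m12 : measurable_fun setT (fun c : R3 => c.1.2).
    by apply: (measurableT_comp (@measurable_snd _ _ R1 R1)); exact: measurable_fst.
  have mc : measurable_fun setT (fun c : R3 => cos c.2).
    have mh : measurable_fun setT (@cos R : R1 -> R1).
      exact: continuous_measurable_fun (@continuous_cos R).
    exact: (measurableT_comp mh (@measurable_snd _ _ R2 R1)).
  have ms : measurable_fun setT (fun c : R3 => sin c.2).
    have mh : measurable_fun setT (@sin R : R1 -> R1).
      exact: continuous_measurable_fun (@continuous_sin R).
    exact: (measurableT_comp mh (@measurable_snd _ _ R2 R1)).
  by rewrite /f /cross /vsub /dir/=; measurable_poly.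
have -> : aimed V = f @^-1` [set 0] by [].
by rewrite -[X in measurable X]setTI; apply: mf.
Qed.

(** For a fixed direction the positions form a line through [V]; axes rotated to that direction make
    it a coordinate axis. *)
Lemma leb3_aimed V : leb3 (aimed V) = 0%E.
Proof.
rewrite leb3_yE; last exact: measurable_aimed.
apply: integral0_eq => th _.
rewrite (@leb2_affine2 R V (cos th, sin th) (- sin th, cos th)); last 2 first.
- rewrite /cross/= mulrN opprK -!expr2 cos2Dsin2; exact: oner_neq0.
- by apply: measurable_ysection; exact: measurable_aimed.
rewrite (_ : _ @^-1` _ = [set z : R2 | z.2 = 0]).
  rewrite leb2_xE integral0_eq ?mule0// => x _.
  rewrite (_ : xsection _ _ = [set 0]) ?lebesgue_measure_set1//.
  by apply/seteqP; split => t; rewrite /xsection/= inE.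
have cE (z : R2) : cross (vsub (affine2 V (cos th, sin th) (- sin th, cos th) z) V) (dir th)
    = - z.2.
  rewrite -[RHS]mulr1 -(cos2Dsin2 th) /cross /vsub /affine2 /dir/=; ring.
apply/seteqP; split => z; rewrite /ysection/= inE /aimed/= cE.
  by move=> /eqP; rewrite oppr_eq0 => /eqP.
by move=> ->; rewrite oppr0.
Qed.

Lemma leb3_setD0 (A N : set R3) : measurable A -> measurable N -> leb3 N = 0%E ->
  leb3 (A `\` N) = leb3 A.
Proof.
move=> mA mN N0; rewrite [RHS](measureDI (@leb3 R) mA mN).
rewrite [X in (_ + X)%E](_ : _ = 0%E) ?adde0//.
by apply: (subset_measure0 _ mN) => //; exact: measurableI.
Qed.

Lemma leb3_setX_angles (B : set R2) : measurable B ->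
  leb3 (B `*` `[0, 2 * pi[%classic) = (leb2 B * (2 * pi)%:E)%E.
Proof.
move=> mB; have pi0 := pi_gt0 R.
have i2 : mu `[0, 2 * pi[%classic = (2 * pi)%:E.
  by rewrite lebesgue_measure_itv/= lte_fin mulr_gt0// oppr0 adde0.
have := @product_measure1E _ _ R2 R1 R (@leb2 R) mu B `[0, 2 * pi[%classic mB
  (measurable_itv _).
by rewrite /leb3 => ->; rewrite [X in (_ * X)%E]i2.
Qed.

End null_lines.

(** * The hit event as a sum over edges *)

Section assembly.
Variables (R : realType) (Omega T : set (pt R)) (n : nat) (v : nat -> pt R) (rmax r : R).
Local Notation mu := (@lebesgue_measure R).
Local Notation R1 := (measurableTypeR R).
Local Notation R2 := (R1 * R1)%type.
Local Notation R3 := (R2 * R1)%type.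
Local Notation vtx := (vtx n v).
Hypotheses (simp : simple_polygon n v) (reg : polygon_region n v T).
Hypotheses (TO : T `<=` Omega).
Hypothesis (near_Omega : forall p q, T q -> eucl_dist p q <= rmax -> Omega p).
Hypotheses (r0 : 0 < r) (rr : r <= rmax).

Let cT : closed T.
Proof. by case: reg => cT _; apply: compact_closed => //; exact: norm_hausdorff. Qed.

Let edge_sub i : (i < n)%N -> edge n v i `<=` T.
Proof.
case: reg => _ [_ eT] ilt p ep.
have : edges_union n v p by exists i.
by rewrite -eT => -[Tp _]; move/closure_id: cT => ->.
Qed.

Lemma raypt0 (p : pt R) th : raypt p th 0 = p.
Proof. by case: p => x y; rewrite /raypt/=; congr pair; ring. Qed.

Lemma eucl_dist_raypt (p : pt R) th (t : R) : 0 <= t -> eucl_dist p (raypt p th t) = t.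
Proof.
move=> t0; rewrite /eucl_dist /enorm /dotp /vsub /raypt/=.
rewrite (_ : _ + _ = t ^+ 2 * (cos th ^+ 2 + sin th ^+ 2)); last by ring.
by rewrite cos2Dsin2 mulr1 sqrtr_sqr ger0_norm.
Qed.

(* The first point of T met is not interior: the ray reaches it from outside T. *)
Let first_hit_edge (c : cfg R) (t : R) : 0 <= t -> ~ T c.1 -> T (raypt c.1 c.2 t) ->
  (forall t' : R, 0 <= t' < t -> ~ T (raypt c.1 c.2 t')) ->
  exists2 i, (i < n)%N & edge n v i (raypt c.1 c.2 t).
Proof.
move=> t0 Tc Tt h; case: reg => _ [_ eT].
suff : edges_union n v (raypt c.1 c.2 t) by [].
rewrite -eT; split; first exact: subset_closure.
move=> iT.
have tpos : 0 < t.
  by rewrite lt_neqAle t0 andbT; apply/eqP => t00; move: Tt; rewrite -t00 raypt0.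
have tc : (fun t' : R => (t', c)) x @[x --> t] --> (t, c).
  exact: (cvg_pair cvg_id (cvg_cst c)).
have ct := cvg_comp _ _ tc (@continuous_raypt R (t, c)).
have /nbhs_ballP[e /= e0 he] := ct _ iT.
(* A time strictly before [t], inside the ball of times at which the ray is still in [T], and
   clipped at 0 to stay on the ray. *)
pose t' := Num.max 0 (t - e / 2).
have e0' : 0 < e := e0.
have t't : t' < t by rewrite gt_max tpos; lra.
apply: (h t'); first by rewrite le_max lexx.
apply: he; rewrite -ball_normE /ball_/= gtr0_norm ?subr_gt0//.
rewrite ltrBlDr; apply: (@lt_le_trans _ _ (e + (t - e / 2))); first by lra.
by rewrite lerD2l le_max lexx orbT.
Qed.

Let D (i : nat) : set R3 := detect_set n v T i r.
Let N : set R3 := \bigcup_(k < n) aimed (vtx k.+1).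

Let mD i : (i < n)%N -> measurable (D i).
Proof. by move=> ilt; apply: measurable_detect_set => //; exact: edge_sub. Qed.

Let mNN0 : measurable N /\ leb3 N = 0%E.
Proof.
rewrite /N bigcup_mkord.
apply: (big_ind (fun X : set R3 => measurable X /\ leb3 X = 0%E)).
- by split; [exact: measurable0|exact: measure0].
- move=> X Y [mX X0] [mY Y0]; split; first exact: measurableU.
  by rewrite [LHS]measureU0.
- by move=> k _; split; [exact: measurable_aimed|exact: leb3_aimed].
Qed.

(** A sensor in [T] hits at distance 0 in every direction, any other first hits an edge. Conversely,
    a detecting sensor is within [rmax] of [T], hence in [Omega]. *)
Lemma hit_event_split : hit_event Omega T r =
  (T `*` `[0, 2 * pi[%classic) `|` \bigcup_(i < n) D i.
Proof.
apply/seteqP; split => c.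
  move=> [Oc [c2 hc]]; have [Tc|Tc] := pselect (T c.1).
    by left; split => //=; rewrite in_itv.
  right; have [t [/andP[t0 tr] Tt h]] := first_hit cT hc.
  have [i ilt ei] := first_hit_edge t0 Tc Tt h.
  exists i => //; split => //; split => //; exists t; split; first by rewrite t0.
  by split.
move=> [[Tc]|[i /= ilt [c2 [Tc [t [/andP[t0 tr] [et _]]]]]]].
  rewrite /= in_itv/= => c2; split; first exact: TO.
  split => //; exists 0; rewrite lexx (ltW r0); split => //.
  by rewrite raypt0.
have Tt := edge_sub ilt et.
split; last by split => //; exists t; rewrite t0.
by apply: near_Omega Tt _; rewrite eucl_dist_raypt// (le_trans tr).
Qed.

(** Both distances are the first hit of [T], so they coincide, and the common point of two distinct
    edges is a vertex. *)
Lemma detect_overlap i j c : (i < n)%N -> (j < n)%N -> i <> j -> D i c -> D j c -> N c.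
Proof.
move=> ilt jlt ij [_ [_ [t [tr [et ht]]]]] [_ [_ [t' [tr' [et' ht']]]]].
have tt : t = t'.
  case: (ltgtP t t') => // lt; exfalso.
    by apply: (ht' t); [case/andP: tr => ->|exact: edge_sub et].
  by apply: (ht t'); [case/andP: tr' => ->|exact: edge_sub et'].
rewrite -tt in et'.
have aim k : raypt c.1 c.2 t = vtx k.+1 -> aimed (vtx k.+1) c.
  by move=> <-; rewrite /aimed /cross /vsub /dir/=; ring.
have [_ [_ h]] := simp.
by have [[_ /aim ?]|[_ /aim ?]] := h i j _ ilt jlt ij et et'; [exists i|exists j].
Qed.

Lemma leb3_hit_event : leb3 (hit_event Omega T r) =
  (leb2 T * (2 * pi)%:E + \sum_(i < n) leb3 (detect_set n v T i r))%E.
Proof.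
have [mN N0] := mNN0; have pi0 := pi_gt0 R.
have mT : @measurable _ R2 T by exact: closed_measurable2.
have mU : measurable (\bigcup_(i < n) D i).
  by apply: bigcup_measurable => i; exact: mD.
rewrite hit_event_split [LHS]measureU//; last 2 first.
- exact: measurableX.
- apply/seteqP; split => // c [[Tc _] [i /= ilt [_ [nT _]]]]; exact: nT.
congr (_ + _)%E.
  exact: leb3_setX_angles.
rewrite -[LHS](leb3_setD0 mU mN N0) setD_bigcupl bigcup_mkord.
rewrite [LHS]measure_bigsetU_ord; last 2 first.
- by move=> i; apply: measurableD => //; exact: mD.
- apply/trivIsetP => i j _ _ ij; apply/seteqP; split => // c [[Di nN] [Dj _]].
  by apply: nN; apply: (@detect_overlap i j) => //; apply/eqP.
by apply: eq_bigr => i _; apply: leb3_setD0 => //; exact: mD.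
Qed.

End assembly.

(** Regroups the near-end corrections by vertex instead of by edge: a cyclic shift by one, in which
    the term of edge 0 becomes the last. *)
Lemma corr_sum_shift (R : realType) (n : nat) (v : nat -> pt R) (r : R) : (0 < n)%N ->
  \sum_(i < n) corr (inner_angle n v (i + n.-1)) (edge_len n v i) r =
  \sum_(i < n) corr (inner_angle n v i) (edge_len n v i.+1) r.
Proof.
case: n => // m _ /=.
have vE k : vtx m.+1 v (k + m.+1) = vtx m.+1 v k by rewrite vtx_addn.
have lE k : edge_len m.+1 v (k + m.+1) = edge_len m.+1 v k.
  by rewrite /edge_len -addSn !vE.
have aE k : inner_angle m.+1 v (k + m.+1) = inner_angle m.+1 v k.
  by rewrite /inner_angle -!addSn !vE.
rewrite big_ord_recl [RHS]big_ord_recr /= [LHS]addrC; congr (_ + _).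
  by apply: eq_bigr => i _; rewrite /bump/= add1n addSnnS aE.
by rewrite add0n -[in RHS](add0n m.+1) lE.
Qed.

Theorem theorem2 (R : realType) (Omega T : set (R * R)) (A : R)
  (n : nat) (v : nat -> (R * R)) (rmax r : R) :
  measurable Omega ->
  @leb2 R Omega = A%:E -> 0 < A ->
  simple_polygon n v ->
  polygon_region n v T ->
  T `<=` Omega ->
  0 < rmax ->
  (forall p q, T q -> eucl_dist p q <= rmax -> Omega p) ->
  0 < r -> r <= rmax ->
  adjacent_only_obstruction n v T r ->
  sensor_prob Omega T r =
    (2 * pi * A)^-1 *
    (2 * perimeter n v * r + 2 * pi * fine (@leb2 R T)
     - \sum_(i < n) (corr (inner_angle n v i) (edge_len n v i) r
                     + corr (inner_angle n v i) (edge_len n v i.+1) r)).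
Proof.
move=> mO lO A0 simp reg TO _ nearO r0 rr adj.
have pi0 := pi_gt0 R.
have n0 : (0 < n)%N by apply: leq_trans (polygon_size simp).
have mT : @measurable _ (measurableTypeR R * measurableTypeR R)%type T.
  case: reg => cT _; apply: closed_measurable2.
  by apply: compact_closed => //; exact: norm_hausdorff.
(* Finiteness of the area of [T], inherited from [Omega], lets the extended-real identity be read in
   the reals. *)
have Tfin : leb2 T \is a fin_num.
  rewrite ge0_fin_numE; last exact: measure_ge0.
  apply: (@le_lt_trans _ _ (@leb2 R Omega)); last by rewrite lO ltry.
  by apply: (@le_measure _ _ _ (@leb2 R)); rewrite ?inE.
rewrite /sensor_prob (leb3_hit_event simp reg TO nearO r0 rr) (leb3_setX_angles mO) lO.
rewrite -(fineK Tfin).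
under eq_bigr => i _.
  rewrite adj// leb3_naive_set// leb3_blocked_near// leb3_blocked_far// -!EFinB.
  over.
rewrite sumEFin -!EFinM -EFinD /=.
rewrite !sumrB corr_sum_shift// [in RHS]big_split/= -mulr_suml -mulr_sumr.
rewrite /perimeter.
by move: (@pi R) pi0 => p p0; field; rewrite (gt_eqF p0) (gt_eqF A0).
Qed.
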